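(* Let $B$ be a Hermitian contraction in $\mathfrak H$, let $X=\begin{bmatrix}X_{11}&X_{12}\\ X_{12}^*&X_{22}\end{bmatrix}$ be a selfadjoint contraction in $\mathfrak D_{K_0^*}\oplus\mathcal H$, and let $\Theta(z)$, $\mathcal N(\lambda)$, $\widehat B_0$, $\widehat B_1$ be the objects associated with $B$ and $X$ as defined in the context. The domain $\mathfrak L:=\mathcal D[\mathcal N(\lambda)]$ of the closed form $\mathcal N(\lambda)[\cdot,\cdot]$ associated with the $m$-sectorial linear relation $\mathcal N(\lambda)$ does not depend on $\lambda$, $\operatorname{Re}\lambda<0$, and equals $\mathfrak L=\operatorname{ran}(I_{\mathcal H}+\Theta(0))^{1/2}$. Moreover, there is an isometry $V:\overline{\operatorname{ran}}(\widehat B_1-\widehat B_0)\to\mathcal H$ such that, with $$Y=(I_{\mathcal H}-\Theta(0))^{1/2}(I_{\mathcal H}+\Theta(0))^{(-1/2)}:\mathfrak L\to\overline{\mathfrak L},$$ where $(I_{\mathcal H}+\Theta(0))^{(-1/2)}$ is the Moore--Penrose pseudo-inverse of $(I_{\mathcal H}+\Theta(0))^{1/2}$, the form admits the representation $$\mathcal N(\lambda)[h,g]=\left(\left(I_{\mathcal H}+V(\widehat B_1-\widehat B_0)^{1/2}\left(\widehat B_0-\frac{1-\lambda}{1+\lambda}\,I_{\mathfrak H}\right)^{-1}(\widehat B_1-\widehat B_0)^{1/2}V^*\right)Yh,Yg\right)$$ for all $\operatorname{Re}\lambda<0$ and $h,g\in\mathfrak L$ (for $\lambda=-1$ the resolvent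 term is understood as $0$).
   Context: All Hilbert spaces are complex and separable. For a contraction $T:H_1\to H_2$, $D_T=(I-T^*T)^{1/2}$ and $\mathfrak D_T$ is the closure of $\operatorname{ran}D_T$. A Hermitian contraction $B$ in $\mathfrak H$ is a linear operator defined on a closed subspace $\mathfrak H_0=\operatorname{dom}B$ of $\mathfrak H$, with $\|Bf\|\le\|f\|$ and $(Bf,g)=(f,Bg)$ for $f,g\in\mathfrak H_0$. Put $\mathfrak N=\mathfrak H\ominus\mathfrak H_0$, $B_0=P_{\mathfrak H_0}B$ (a selfadjoint contraction in $\mathfrak H_0$), and let $K_0:\mathfrak D_{B_0}\to\mathfrak N$ be the contraction determined by $K_0D_{B_0}f=P_{\mathfrak N}Bf$, $f\in\mathfrak H_0$. Thus $K_0^*:\mathfrak N\to\mathfrak D_{B_0}\subseteq\mathfrak H_0$ and $D_{K_0^*}$ acts in $\mathfrak N$. Given $X$, define in $\mathfrak H=\mathfrak H_0\oplus\mathfrak N$ $$\widetilde C=\begin{bmatrix}B_0&D_{B_0}K_0^*\\ K_0D_{B_0}&-K_0B_0K_0^*+D_{K_0^*}X_{11}D_{K_0^*}\end{bmatrix},\qquad \widetilde M=\begin{bmatrix}0\\ D_{K_0^*}X_{12}\end{bmatrix}:\mathcal H\to\mathfrak H_0\oplus\mathfrak N,$$ so that $\widetilde B_X=\begin{bmatrix}\widetilde C&\widetilde M\\ \widetilde M^*&X_{22}\end{bmatrix}$ is a selfadjoint contractive extension of $B$ in $\mathfrak H\oplus\mathcal H$. Put $$\Theta(z)=X_{22}+z\widetilde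 M^*(I_{\mathfrak H}-z\widetilde C)^{-1}\widetilde M,\qquad z\in\mathbb C\setminus\{(-\infty,-1]\cup[1,+\infty)\},$$ (so $\Theta(0)=X_{22}$) and, for $\lambda\in\mathbb C\setminus[0,+\infty)$, with $z=\frac{1+\lambda}{1-\lambda}$, define the linear relation in $\mathcal H$ $$\mathcal N(\lambda)=-I_{\mathcal H}+2\left(I_{\mathcal H}+\Theta(z)\right)^{-1}=\left\{\{(I_{\mathcal H}+\Theta(z))h,(I_{\mathcal H}-\Theta(z))h\}:h\in\mathcal H\right\}.$$ It is $m$-sectorial for $\operatorname{Re}\lambda<0$ (and nonnegative selfadjoint for $\lambda<0$). The closed form $\mathcal N(\lambda)[\cdot,\cdot]$ associated with it, with domain $\mathcal D[\mathcal N(\lambda)]$, is the closure of the sectorial form $(u',v)$, where $\{u,u'\},\{v,v'\}\in\mathcal N(\lambda)$. Further, with $\widehat Z_0=\left((I+X)_{\mathfrak D_{K_0^*}}-I\right)\upharpoonright\mathfrak D_{K_0^*}$ and $\widehat Z_1=\left(I-(I-X)_{\mathfrak D_{K_0^*}}\right)\upharpoonright\mathfrak D_{K_0^*}$, $$\widehat B_j=\begin{bmatrix}B_0&D_{B_0}K_0^*\\ K_0D_{B_0}&-K_0B_0K_0^*+D_{K_0^*}\widehat Z_jD_{K_0^*}\end{bmatrix}\ \text{ in }\mathfrak H_0\oplus\mathfrak N,\qquad j=0,1;$$ then $\widehat B_0\le\widehat B_1$. Here for a bounded nonnegative operator $S$ in a Hilbert space $L$ and a closed subspace $K\subseteq L$,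 the shorted operator is $S_K=\max\{Z\in\mathbf L(L):0\le Z\le S,\ \operatorname{ran}Z\subseteq K\}$. *)

(* Defs.v *)
From HB Require Import structures.
From mathcomp Require Import all_boot all_order all_algebra sesquilinear.
From mathcomp Require Import complex.
From mathcomp Require Import boolp classical_sets functions cardinality reals.
From mathcomp Require Import topology normedtype.
From mathcomp Require Import ring.

Set Implicit Arguments.
Unset Strict Implicit.
Unset Printing Implicit Defensive.

Import Order.TTheory GRing.Theory Num.Theory Num.Def.
Import numFieldTopology.Exports numFieldNormedType.Exports.

Local Open Scope classical_set_scope.
Local Open Scope ring_scope.
Local Open Scope complex_scope.

(* The inner product is linear in its first argument. *)
HB.mixin Record NormedModule_isHilbert (R : realType) H
    & NormedModule R[i] H := {
  hdot : {dot H for (@Num.conj R[i])};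
  hdotxx : forall x : H, hdot x x = `|x| ^+ 2
}.

#[short(type="hilbertType")]
HB.structure Definition Hilbert (R : realType) :=
  {H of CompleteNormedModule R[i] H & NormedModule_isHilbert R H}.

Notation "''[' u , v ]" := (hdot u v) : ring_scope.

Definition separable_space (T : topologicalType) :=
  exists2 A : set T, countable A & dense A.

Section HilbertTheory.
Variables (R : realType) (H : hilbertType R).
Implicit Types x y : H.

Lemma hdotC x y : '[x, y] = Num.conj '[y, x].
Proof. by rewrite hermC /= expr0 mul1r. Qed.

Lemma hdot_normr_le x y : `|'[x, y]| <= `|x| * `|y|.
Proof.
have [->|y0] := eqVneq y 0; first by rewrite linear0r !normr0 mulr0.
have ny : 0 < `|y| by rewrite normr_gt0.
have ny2 : '[y, y] != 0 by rewrite hdotxx expf_neq0 // gt_eqF.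
pose a := '[x, y] / '[y, y].
have ry : Num.conj '[y, y] = '[y, y] by rewrite -hdotC.
have : 0 <= '[x - a *: y, x - a *: y] by rewrite hdotxx exprn_ge0.
rewrite linearBl /= linearBr /= linearZl_LR /= linearBr /= !linearZr_LR /=.
have -> : '[y, x] = Num.conj '[x, y] by rewrite hdotC.
rewrite /a rmorphM /= fmorphV /= ry.
have -> : '[x, y] / '[y, y] * (Num.conj '[x, y] - Num.conj '[x, y] / '[y, y] * '[y, y]) = 0.
  by rewrite divfK // subrr mulr0.
rewrite subr0 subr_ge0 mulrAC (mulrC (Num.conj _)) -normCK !hdotxx.
rewrite ler_pdivrMr ?exprn_gt0 // -exprMn.
by rewrite ler_sqr ?nnegrE // mulr_ge0.
Qed.

Lemma closed_hdot_eq0 y : closed [set x : H | '[x, y] = 0].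
Proof.
move=> x xcl /=; apply/eqP; apply: contraT => nz.
have nzx : 0 < `|'[x, y]| by rewrite normr_gt0.
have y0 : 0 < `|y|.
  by rewrite normr_gt0; apply: contraNneq nz => ->; rewrite linear0r.
have e0 : 0 < `|'[x, y]| / `|y| by rewrite divr_gt0.
have [z [/= z0]] := xcl _ (nbhsx_ballx x _ e0).
rewrite -ball_normE /= ltr_pdivlMr // => /(le_lt_trans (hdot_normr_le _ _)).
by rewrite linearBl /= z0 subr0 ltxx.
Qed.

End HilbertTheory.

Record csubspace (R : realType) (H : hilbertType R) := CSubspace {
  cset :> set H;
  cset_closed : closed cset;
  cset_submod : GRing.submod_closed [pred x | x \in cset]
}.

Section ClosedSubspace.
Variables (R : realType) (H : hilbertType R) (K : csubspace H).

Definition cpred : {pred H} := [pred x | x \in cset K].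

HB.instance Definition _ := GRing.isSubmodClosed.Build R[i] H cpred
  (GRing.submod_closed_semi (cset_submod K)).

Record csub := CSub { csval : H; csvalP : csval \in cpred }.

HB.instance Definition _ := [isSub for csval].
HB.instance Definition _ := [Choice of csub by <:].
HB.instance Definition _ := [SubChoice_isSubLmodule of csub by <:].

Lemma csval_is_linear : linear csval. Proof. by []. Qed.

HB.instance Definition _ :=
  GRing.isLinear.Build R[i] csub H _ csval csval_is_linear.

Let csnorm (x : csub) : R[i] := `|csval x|.

Let csnormD x y : csnorm (x + y) <= csnorm x + csnorm y.
Proof. by rewrite /csnorm linearD ler_normD. Qed.

Let csnormZ a x : csnorm (a *: x) = `|a| * csnorm x.
Proof. by rewrite /csnorm linearZ normrZ. Qed.

Let csnorm0 x : csnorm x = 0 -> x = 0.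
Proof. by move/normr0_eq0 => x0; apply/val_inj; rewrite /= x0. Qed.

HB.instance Definition _ :=
  Lmodule_isNormed.Build R[i] csub csnormD csnormZ csnorm0.
HB.instance Definition _ := isPointed.Build csub 0.

Lemma csub_normE (x : csub) : `|x| = `|csval x|. Proof. by []. Qed.

Lemma csval_continuous : continuous csval.
Proof.
move=> x A /nbhs_ballP[e /= e0 eA]; apply/nbhs_ballP; exists e => // y.
rewrite -ball_normE /= => xy; apply: eA; move: xy; rewrite -ball_normE /=.
by rewrite csub_normE linearB.
Qed.

Let csub_complete (F : set_system csub) :
  ProperFilter F -> cauchy F -> cvg F.
Proof.
move=> FF /cauchy_ballP Fc.
have /cauchy_cvg /cvg_ex[l Fl] : cauchy (csval @ F).
  apply/cauchy_ballP => e e0; have := Fc e e0.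
  rewrite !near_simpl => -[[A B] /= [FA FB] AB].
  exists (csval @` A, csval @` B) => /=.
    by split; [move: FA|move: FB]; apply: filterS => x Ax; exists x.
  move=> [_ _] /= [[a Aa <-] [b Bb <-]].
  by have := AB (a, b) (conj Aa Bb); rewrite /= -!ball_normE /= -linearB.
have Kl : cset K l.
  apply: cset_closed => A /Fl FA.
  have [x Ax] : (csval @^-1` A) !=set0 by exact: (@filter_ex _ F).
  by exists (csval x); split => //; have := csvalP x; rewrite inE.
have Kl' : l \in cpred by rewrite inE.
apply/cvg_ex; exists (CSub Kl'); apply/cvgrPdist_lt => e e0.
by move/cvgrPdist_lt: Fl => /(_ e e0); apply: filterS => x; rewrite csub_normE linearB.
Qed.

HB.instance Definition _ := Uniform_isComplete.Build csub csub_complete.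

Definition csdot (x y : csub) : R[i] := '[csval x, csval y].

Let csdot_bilinear : bilinear_for
  (GRing.Scale.Law.clone _ _ *%R _)
  (GRing.Scale.Law.clone _ _ (@Num.conj R[i] \; *%R) _) csdot.
Proof.
split => [y a u v|x a u v]; rewrite /csdot csval_is_linear.
  by rewrite linearDl /= linearZl_LR.
by rewrite linearDr /= linearZr_LR.
Qed.

HB.instance Definition _ :=
  @bilinear_isBilinear.Build R[i] csub csub R[i] _ _ csdot csdot_bilinear.

Let csdotC x y : csdot x y = (-1) ^+ false * Num.conj (csdot y x).
Proof. by rewrite expr0 mul1r /csdot hdotC. Qed.

HB.instance Definition _ :=
  @isHermitianSesquilinear.Build R[i] csub false (@Num.conj R[i]) csdot csdotC.

Let csdot_gt0 x : x != 0 -> 0 < csdot x x.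
Proof. by move=> x0; rewrite /csdot hdotxx -csub_normE exprn_gt0 ?normr_gt0. Qed.

HB.instance Definition _ :=
  @isDotProduct.Build R[i] csub csdot csdot_gt0.

Let csdotxx x : csdot x x = `|x| ^+ 2. Proof. exact: hdotxx. Qed.

HB.instance Definition _ :=
  @NormedModule_isHilbert.Build R csub csdot csdotxx.

End ClosedSubspace.

(* An alias of the product, to carry the Hilbert norm instead of the max norm. *)
Definition hsum (R : realType) (U V : hilbertType R) : Type := (U * V)%type.

Section HilbertSum.
Variables (R : realType) (U V : hilbertType R).

HB.instance Definition _ := GRing.Lmodule.copy (hsum U V) (U * V)%type.

Implicit Types x y : hsum U V.

Definition hsum_norm x : R[i] := sqrtC (`|x.1| ^+ 2 + `|x.2| ^+ 2).

Let sqr_ge0 x : 0 <= `|x.1| ^+ 2 + `|x.2| ^+ 2.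
Proof. by rewrite addr_ge0 // exprn_ge0. Qed.

Lemma hsum_norm_ge0 x : 0 <= hsum_norm x.
Proof. by rewrite sqrtC_ge0. Qed.

Lemma hsum_normK x : hsum_norm x ^+ 2 = `|x.1| ^+ 2 + `|x.2| ^+ 2.
Proof. by rewrite sqrtCK. Qed.

Let normD x y : hsum_norm (x + y) <= hsum_norm x + hsum_norm y.
Proof.
rewrite -ler_sqr ?nnegrE ?addr_ge0 ?hsum_norm_ge0 // sqrrD !hsum_normK.
have key : `|x.1| * `|y.1| + `|x.2| * `|y.2| <= hsum_norm x * hsum_norm y.
  rewrite -ler_sqr ?nnegrE ?mulr_ge0 ?hsum_norm_ge0 ?addr_ge0 ?mulr_ge0 //.
  rewrite exprMn !hsum_normK -subr_ge0.
  set a := `|x.1|; set b := `|x.2|; set c := `|y.1|; set d := `|y.2|.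
  have -> : (a ^+ 2 + b ^+ 2) * (c ^+ 2 + d ^+ 2) - (a * c + b * d) ^+ 2 =
            (a * d - b * c) ^+ 2.
    by ring.
  by rewrite real_exprn_even_ge0 // rpredB // rpredM // normr_real.
have le1 : `|x.1 + y.1| ^+ 2 <= (`|x.1| + `|y.1|) ^+ 2.
  by rewrite ler_sqr ?nnegrE ?addr_ge0 // ler_normD.
have le2 : `|x.2 + y.2| ^+ 2 <= (`|x.2| + `|y.2|) ^+ 2.
  by rewrite ler_sqr ?nnegrE ?addr_ge0 // ler_normD.
apply: (le_trans (lerD le1 le2)).
have -> : (`|x.1| + `|y.1|) ^+ 2 + (`|x.2| + `|y.2|) ^+ 2 =
  `|x.1| ^+ 2 + `|x.2| ^+ 2 + (`|x.1| * `|y.1| + `|x.2| * `|y.2|) *+ 2 +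
  (`|y.1| ^+ 2 + `|y.2| ^+ 2) by ring.
by rewrite lerD2r lerD2l lerMn2r key.
Qed.

Let normZ a x : hsum_norm (a *: x) = `|a| * hsum_norm x.
Proof.
rewrite /hsum_norm /= !normrZ !exprMn -mulrDr sqrtCM ?nnegrE ?exprn_ge0 //.
by rewrite sqrCK.
Qed.

Let norm_eq0 x : hsum_norm x = 0 -> x = 0.
Proof.
move/eqP; rewrite sqrtC_eq0 paddr_eq0 ?exprn_ge0 // !sqrf_eq0 !normr_eq0.
by case: x => a b /= /andP[/eqP-> /eqP->].
Qed.

HB.instance Definition _ :=
  Lmodule_isNormed.Build R[i] (hsum U V) normD normZ norm_eq0.
HB.instance Definition _ := isPointed.Build (hsum U V) 0.

Lemma hsum_normE x : `|x| = sqrtC (`|x.1| ^+ 2 + `|x.2| ^+ 2).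
Proof. by []. Qed.

Lemma hsum_norm1_le x : `|x.1| <= `|x|.
Proof.
rewrite -ler_sqr ?nnegrE // hsum_normE sqrtCK.
by rewrite lerDl exprn_ge0.
Qed.

Lemma hsum_norm2_le x : `|x.2| <= `|x|.
Proof.
rewrite -ler_sqr ?nnegrE // hsum_normE sqrtCK.
by rewrite lerDr exprn_ge0.
Qed.

Lemma hsum_norm_leD x : `|x| <= `|x.1| + `|x.2|.
Proof.
rewrite -ler_sqr ?nnegrE ?addr_ge0 // hsum_normE sqrtCK sqrrD.
by rewrite addrAC lerDl mulrn_wge0 // mulr_ge0.
Qed.

Let hsum_complete (F : set_system (hsum U V)) :
  ProperFilter F -> cauchy F -> cvg F.
Proof.
move=> FF /cauchy_ballP Fc.
have /cauchy_cvg /cvg_ex[l1 Fl1] : cauchy ((fun x : hsum U V => x.1) @ F).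
  apply/cauchy_ballP => e e0; have := Fc e e0.
  rewrite !near_simpl => -[[A B] /= [FA FB] AB].
  exists ([set x.1 | x in A], [set x.1 | x in B]) => /=.
    by split; [move: FA|move: FB]; apply: filterS => x Ax; exists x.
  move=> [_ _] /= [[a Aa <-] [b Bb <-]].
  have := AB (a, b) (conj Aa Bb); rewrite /= -!ball_normE /=.
  by apply: le_lt_trans; exact: (hsum_norm1_le (a - b)).
have /cauchy_cvg /cvg_ex[l2 Fl2] : cauchy ((fun x : hsum U V => x.2) @ F).
  apply/cauchy_ballP => e e0; have := Fc e e0.
  rewrite !near_simpl => -[[A B] /= [FA FB] AB].
  exists ([set x.2 | x in A], [set x.2 | x in B]) => /=.
    by split; [move: FA|move: FB]; apply: filterS => x Ax; exists x.
  move=> [_ _] /= [[a Aa <-] [b Bb <-]].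
  have := AB (a, b) (conj Aa Bb); rewrite /= -!ball_normE /=.
  by apply: le_lt_trans; exact: (hsum_norm2_le (a - b)).
apply/cvg_ex; exists ((l1, l2) : hsum U V); apply/cvgrPdist_lt => e e0.
have e20 : 0 < e / 2 by rewrite divr_gt0.
have h1 : F [set x : hsum U V | `|l1 - x.1| < e / 2].
  by move/cvgrPdist_lt: Fl1 => /(_ _ e20).
have h2 : F [set x : hsum U V | `|l2 - x.2| < e / 2].
  by move/cvgrPdist_lt: Fl2 => /(_ _ e20).
apply: filterS (filterI h1 h2) => x /= [x1 x2].
apply: (le_lt_trans (hsum_norm_leD _)).
by rewrite [ltRHS](splitr e); apply: ltrD.
Qed.

HB.instance Definition _ := Uniform_isComplete.Build (hsum U V) hsum_complete.

Definition hsum_dot x y : R[i] := '[x.1, y.1] + '[x.2, y.2].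

Let hsum_dot_bilinear : bilinear_for
  (GRing.Scale.Law.clone _ _ *%R _)
  (GRing.Scale.Law.clone _ _ (@Num.conj R[i] \; *%R) _) hsum_dot.
Proof.
split => [y a u v|x a u v]; rewrite /hsum_dot /=.
  by rewrite !linearDl /= !linearZl_LR /= mulrDr addrACA.
by rewrite !linearDr /= !linearZr_LR /= mulrDr addrACA.
Qed.

HB.instance Definition _ := @bilinear_isBilinear.Build
  R[i] (hsum U V) (hsum U V) R[i] _ _ hsum_dot hsum_dot_bilinear.

Let hsum_dotC x y :
  hsum_dot x y = (-1) ^+ false * Num.conj (hsum_dot y x).
Proof. by rewrite expr0 mul1r /hsum_dot rmorphD /= -!hdotC. Qed.

HB.instance Definition _ := @isHermitianSesquilinear.Build
  R[i] (hsum U V) false (@Num.conj R[i]) hsum_dot hsum_dotC.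

Let hsum_dotxx x : hsum_dot x x = `|x| ^+ 2.
Proof. by rewrite /hsum_dot !hdotxx hsum_normE sqrtCK. Qed.

Let hsum_dot_gt0 x : x != 0 -> 0 < hsum_dot x x.
Proof. by move=> x0; rewrite hsum_dotxx exprn_gt0 ?normr_gt0. Qed.

HB.instance Definition _ :=
  @isDotProduct.Build R[i] (hsum U V) hsum_dot hsum_dot_gt0.

HB.instance Definition _ :=
  @NormedModule_isHilbert.Build R (hsum U V) hsum_dot hsum_dotxx.

End HilbertSum.

Record bop (R : realType) (U V : hilbertType R) := BOp {
  bop_fun :> U -> V;
  bop_linear : linear bop_fun;
  bop_continuous : continuous bop_fun
}.

HB.instance Definition _ (R : realType) (U V : hilbertType R) (T : bop U V) :=
  GRing.isLinear.Build R[i] U V _ (bop_fun T) (bop_linear T).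

Section BoundedOperators.
Variables (R : realType) (U V W : hilbertType R).

Lemma bop_ext (S T : bop U V) : S =1 T -> S = T.
Proof.
case: S T => [f fl fc] [g gl gc] /= /funext fg; subst g.
by congr BOp; exact: Prop_irrelevance.
Qed.

HB.instance Definition _ := gen_eqMixin (bop U V).
HB.instance Definition _ := gen_choiceMixin (bop U V).

Let zero_linear : linear (fun _ : U => 0 : V).
Proof. by move=> a x y; rewrite scaler0 addr0. Qed.

Definition bop_zero : bop U V := BOp zero_linear (fun x => cvg_cst _).

Let opp_linear (T : bop U V) : linear (fun x => - T x).
Proof. by move=> a x y; rewrite linearP opprD scalerN. Qed.

Let opp_continuous (T : bop U V) : continuous (fun x => - T x).
Proof. by move=> x; apply: cvgN; exact: bop_continuous. Qed.

Definition bop_opp T : bop U V := BOp (opp_linear T) (@opp_continuous T).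

Let add_linear (S T : bop U V) : linear (fun x => S x + T x).
Proof. by move=> a x y; rewrite !linearP scalerDr addrACA. Qed.

Let add_continuous (S T : bop U V) : continuous (fun x => S x + T x).
Proof. by move=> x; apply: cvgD; exact: bop_continuous. Qed.

Definition bop_add S T : bop U V :=
  BOp (add_linear S T) (@add_continuous S T).

Let scale_linear (c : R[i]) (T : bop U V) : linear (fun x => c *: T x).
Proof. by move=> a x y; rewrite linearP scalerDr !scalerA mulrC. Qed.

Let scale_continuous (c : R[i]) (T : bop U V) : continuous (fun x => c *: T x).
Proof. by move=> x; apply: cvgZl_tmp; exact: bop_continuous. Qed.

Definition bop_scale c T : bop U V :=
  BOp (scale_linear c T) (@scale_continuous c T).

Let addA : associative bop_add.
Proof. by move=> A B C; apply: bop_ext => x /=; rewrite addrA. Qed.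

Let addC : commutative bop_add.
Proof. by move=> A B; apply: bop_ext => x /=; rewrite addrC. Qed.

Let add0 : left_id bop_zero bop_add.
Proof. by move=> A; apply: bop_ext => x /=; rewrite add0r. Qed.

Let addN : left_inverse bop_zero bop_opp bop_add.
Proof. by move=> A; apply: bop_ext => x /=; rewrite addNr. Qed.

HB.instance Definition _ := GRing.isZmodule.Build (bop U V) addA addC add0 addN.

Let scaleA a b (T : bop U V) : bop_scale a (bop_scale b T) = bop_scale (a * b) T.
Proof. by apply: bop_ext => x /=; rewrite scalerA. Qed.

Let scale1 : left_id 1 bop_scale.
Proof. by move=> T; apply: bop_ext => x /=; rewrite scale1r. Qed.

Let scaleDr : right_distributive bop_scale +%R.
Proof. by move=> a S T; apply: bop_ext => x /=; rewrite scalerDr. Qed.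

Let scaleDl T : {morph bop_scale^~ T : a b / a + b}.
Proof. by move=> a b; apply: bop_ext => x /=; rewrite scalerDl. Qed.

HB.instance Definition _ := GRing.Zmodule_isLmodule.Build R[i] (bop U V)
  scaleA scale1 scaleDr scaleDl.

Let comp_linear (S : bop V W) (T : bop U V) : linear (S \o T).
Proof. by move=> a x y; rewrite /= !linearP. Qed.

Let comp_continuous (S : bop V W) (T : bop U V) : continuous (S \o T).
Proof. by move=> x; apply: continuous_comp; exact: bop_continuous. Qed.

Definition bop_comp S T : bop U W :=
  BOp (comp_linear S T) (@comp_continuous S T).

Let id_linear : linear (@id U). Proof. by []. Qed.

Let id_continuous : continuous (@id U).
Proof. by move=> x; exact: cvg_id. Qed.

Definition bop_id : bop U U := BOp id_linear id_continuous.

End BoundedOperators.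

Notation "S \bo T" := (bop_comp S T)
  (at level 40, left associativity) : ring_scope.
Notation "'\id_' U" := (bop_id U) (at level 8, U at level 2) : ring_scope.

Section OperatorNotions.
Variables (R : realType).
Implicit Types U V W : hilbertType R.

Definition contractive U V (T : bop U V) := forall x, `|T x| <= `|x|.

Definition isometric U V (T : bop U V) := forall x, `|T x| = `|x|.

Definition selfadjoint U (T : bop U U) := forall x y, '[T x, y] = '[x, T y].

(* In [R[i]], [0 <= c] entails that [c] is real. *)
Definition op_nonneg U (T : bop U U) := forall x, 0 <= '[T x, x].

Definition op_le U (S T : bop U U) := op_nonneg (T - S).

(* The operators below given by [xget 0 P] are the unique ones satisfying [P]
   whenever such an operator exists. *)

Definition adj U V (T : bop U V) : bop V U :=
  xget 0 [set S : bop V U | forall x y, '[T x, y] = '[x, S y]].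

Definition bop_sqrt U (T : bop U U) : bop U U :=
  xget 0 [set S : bop U U | op_nonneg S /\ S \bo S = T].

Definition bop_inv U (T : bop U U) : bop U U :=
  xget 0 [set S : bop U U | S \bo T = \id_U /\ T \bo S = \id_U].

(* The Moore-Penrose pseudo-inverse, a possibly unbounded operator with domain
   [ran A + (ran A)^perp]: [mp_inv A y] is the vector [x] orthogonal to [ker A]
   such that [A x] is the orthogonal projection of [y] onto the closure of
   [ran A]. Its value is irrelevant outside this domain. *)
Definition mp_inv U V (A : bop U V) (y : V) : U :=
  xget 0 [set x | (forall k, A k = 0 -> '[x, k] = 0) /\
                  (forall w, '[y - A x, A w] = 0)].

Definition cincl U (K : csubspace U) : bop (csub K) U :=
  BOp (@csval_is_linear R U K) (@csval_continuous R U K).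

Definition cproj U (K : csubspace U) : bop U (csub K) :=
  xget 0 [set P : bop U (csub K) |
           forall x k, cset K k -> '[x - csval (P x), k] = 0].

End OperatorNotions.

Section SubspaceConstructions.
Variables (R : realType).
Implicit Types U V : hilbertType R.

Let ran_closure_submod U V (T : bop U V) :
  GRing.submod_closed [pred y | y \in closure (range T)].
Proof.
split; first by rewrite inE; apply: subset_closure; exists 0 => //; rewrite linear0.
move=> a x y; rewrite !inE => xcl ycl A /= Aaxy.
have c : (fun z : V * V => a *: z.1 + z.2) @ nbhs (x, y) --> a *: x + y.
  by apply: cvgD; [apply: cvgZl_tmp; exact: cvg_fst|exact: cvg_snd].
have [[P Q] /= [Px Qy] PQ] := c _ Aaxy.
have [_ [[u _ <-] Pu]] := xcl _ Px; have [_ [[v _ <-] Qv]] := ycl _ Qy.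
exists (T (a *: u + v)); split; first by exists (a *: u + v).
by rewrite linearP; exact: (PQ (_, _)).
Qed.

Definition ran_closure U V (T : bop U V) : csubspace V :=
  CSubspace (@closed_closure _ (range T)) (ran_closure_submod T).

Definition ortho_set U (A : set U) : set U :=
  [set x | forall y, A y -> '[x, y] = 0].

Let ortho_closed U (A : set U) : closed (ortho_set A).
Proof.
move=> x xcl y Ay; apply: closed_hdot_eq0; apply: closureS xcl.
by move=> z /(_ _ Ay).
Qed.

Let ortho_submod U (A : set U) :
  GRing.submod_closed [pred x | x \in ortho_set A].
Proof.
split; first by rewrite inE => y _; rewrite linear0l.
move=> a x y; rewrite !inE => x0 y0 z Az.
by rewrite linearDl /= linearZl_LR /= x0 // y0 // mulr0 addr0.
Qed.

Definition cortho U (A : set U) : csubspace U :=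
  CSubspace (@ortho_closed U A) (ortho_submod A).

Definition defect U V (T : bop U V) : bop U U :=
  bop_sqrt (\id_U - adj T \bo T).

Definition defect_space U V (T : bop U V) : csubspace U :=
  ran_closure (defect T).

Definition defect_to U V (T : bop U V) : bop U (csub (defect_space T)) :=
  cproj (defect_space T) \bo defect T.

Definition shorted U (S : bop U U) (K : set U) : bop U U :=
  let P := [set Z | [/\ op_nonneg Z, op_le Z S & range Z `<=` K]] in
  xget 0 [set Z | P Z /\ forall Z', P Z' -> op_le Z' Z].

End SubspaceConstructions.

Section HilbertSumMaps.
Variables (R : realType) (U V : hilbertType R).

Let inl_linear : linear (fun u : U => (u, 0) : hsum U V).
Proof.
by move=> a x y; apply: injective_projections => //=; rewrite scaler0 addr0.
Qed.

Let inr_linear : linear (fun v : V => (0, v) : hsum U V).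
Proof.
by move=> a x y; apply: injective_projections => //=; rewrite scaler0 addr0.
Qed.

Let inl_continuous : continuous (fun u : U => (u, 0) : hsum U V).
Proof.
move=> x A /nbhs_ballP[e /= e0 eA]; apply/nbhs_ballP; exists e => // y.
rewrite -ball_normE /= => xy; apply: eA; move: xy; rewrite -ball_normE /=.
rewrite hsum_normE /= subrr normr0 expr0n addr0.
by rewrite sqrCK.
Qed.

Let inr_continuous : continuous (fun v : V => (0, v) : hsum U V).
Proof.
move=> x A /nbhs_ballP[e /= e0 eA]; apply/nbhs_ballP; exists e => // y.
rewrite -ball_normE /= => xy; apply: eA; move: xy; rewrite -ball_normE /=.
rewrite hsum_normE /= subrr normr0 expr0n add0r.
by rewrite sqrCK.
Qed.

Let fst_linear : linear (fun x : hsum U V => x.1). Proof. by []. Qed.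
Let snd_linear : linear (fun x : hsum U V => x.2). Proof. by []. Qed.

Let fst_continuous : continuous (fun x : hsum U V => x.1).
Proof.
move=> x A /nbhs_ballP[e /= e0 eA]; apply/nbhs_ballP; exists e => // y.
rewrite -ball_normE /= => xy; apply: eA; move: xy; rewrite -ball_normE /=.
by apply: le_lt_trans; exact: (hsum_norm1_le (x - y)).
Qed.

Let snd_continuous : continuous (fun x : hsum U V => x.2).
Proof.
move=> x A /nbhs_ballP[e /= e0 eA]; apply/nbhs_ballP; exists e => // y.
rewrite -ball_normE /= => xy; apply: eA; move: xy; rewrite -ball_normE /=.
by apply: le_lt_trans; exact: (hsum_norm2_le (x - y)).
Qed.

Definition hinl : bop U (hsum U V) := BOp inl_linear inl_continuous.
Definition hinr : bop V (hsum U V) := BOp inr_linear inr_continuous.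
Definition hfst : bop (hsum U V) U := BOp fst_linear fst_continuous.
Definition hsnd : bop (hsum U V) V := BOp snd_linear snd_continuous.

End HilbertSumMaps.

Section ClosedForm.
Variables (R : realType) (U : hilbertType R).

Section FormClosure.
Variables (D : set U) (t : U -> U -> R[i]).

Definition form_cvg (u_ : nat -> U) (u : U) :=
  [/\ forall n, D (u_ n), u_ @ \oo --> u &
      forall e : R[i], 0 < e -> exists m, forall n k, (m <= n)%N -> (m <= k)%N ->
        `|t (u_ n - u_ k) (u_ n - u_ k)| < e].

Definition form_closure_dom : set U := [set u | exists u_, form_cvg u_ u].

Definition form_closure (u v : U) : R[i] :=
  xget 0 [set c : R[i] | forall u_ v_, form_cvg u_ u -> form_cvg v_ v ->
    (fun n => t (u_ n) (v_ n)) @ \oo --> (c : R[i]^o)].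

End FormClosure.

Variable N : set (U * U).

Definition rel_dom : set U := [set u | exists u', N (u, u')].

(* [(u', v)] for [{u, u'}] in [N]; it does not depend on the choice of [u']
   when [v] is in the domain of [N] and [N] is m-sectorial, since then the
   multivalued part of [N] is orthogonal to its domain. *)
Definition rel_form (u v : U) : R[i] :=
  xget 0 [set c : R[i] | exists2 u', N (u, u') & c = '[u', v]].

Definition closed_form_dom : set U := form_closure_dom rel_dom rel_form.

Definition closed_form : U -> U -> R[i] := form_closure rel_dom rel_form.

End ClosedForm.

Section HermitianContraction.
Variables (R : realType) (H : hilbertType R) (H0 : csubspace H).
Variable B : bop (csub H0) H.

Definition hermitian_contraction :=
  contractive B /\ forall f g, '[B f, csval g] = '[csval f, B g].

Definition Nsp : csubspace H := cortho H0.

Definition B0 : bop (csub H0) (csub H0) := cproj H0 \bo B.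

Definition K0 : bop (csub (defect_space B0)) (csub Nsp) :=
  xget 0 [set K : bop (csub (defect_space B0)) (csub Nsp) | contractive K /\
           forall f, K (defect_to B0 f) = cproj Nsp (B f)].

(* The space [D_(K0^* )], a closed subspace of [csub Nsp]. *)
Definition Dsp : csubspace (csub Nsp) := defect_space (adj K0).

(* The operator in [H = H0 + N] with blocks [B0], [D_B0 K0^*], [K0 D_B0] and
   [- K0 B0 K0^* + D_K0^* Z D_K0^*]; in [K0 B0 K0^*] the operator [B0] is
   restricted to its invariant subspace [defect_space B0]. *)
Definition block_op (Z : bop (csub Dsp) (csub Dsp)) : bop H H :=
  let iH := cincl H0 in let pH := cproj H0 in
  let iN := cincl Nsp in let pN := cproj Nsp in
  let iD := cincl (defect_space B0) in let pD := cproj (defect_space B0) in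
    iH \bo B0 \bo pH
  + iH \bo (defect B0 \bo iD \bo adj K0) \bo pN
  + iN \bo (K0 \bo defect_to B0) \bo pH
  + iN \bo (- (K0 \bo pD \bo B0 \bo iD \bo adj K0)
            + defect (adj K0) \bo cincl Dsp \bo Z \bo defect_to (adj K0)) \bo pN.

Variables (G : hilbertType R) (X : bop (hsum (csub Dsp) G) (hsum (csub Dsp) G)).

Definition X11 : bop (csub Dsp) (csub Dsp) := hfst _ _ \bo X \bo hinl _ _.
Definition X12 : bop G (csub Dsp) := hfst _ _ \bo X \bo hinr _ _.
Definition X22 : bop G G := hsnd _ _ \bo X \bo hinr _ _.

Definition Ctilde : bop H H := block_op X11.

Definition Mtilde : bop G H :=
  cincl Nsp \bo defect (adj K0) \bo cincl Dsp \bo X12.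

Definition Theta (z : R[i]) : bop G G :=
  X22 + z *: (adj Mtilde \bo bop_inv (\id_H - z *: Ctilde) \bo Mtilde).

Definition Nrel (lam : R[i]) : set (G * G) :=
  let Th := Theta ((1 + lam) / (1 - lam)) in
  [set ((\id_G + Th) h, (\id_G - Th) h) | h in [set: G]].

(* [Dsp] as a subspace of [hsum (csub Dsp) G]. *)
Definition Dsum : set (hsum (csub Dsp) G) := [set x | x.2 = 0].

Definition Zhat0 : bop (csub Dsp) (csub Dsp) :=
  hfst _ _ \bo (shorted (\id_(hsum (csub Dsp) G) + X) Dsum - \id_(hsum (csub Dsp) G))
    \bo hinl _ _.

Definition Zhat1 : bop (csub Dsp) (csub Dsp) :=
  hfst _ _ \bo (\id_(hsum (csub Dsp) G) - shorted (\id_(hsum (csub Dsp) G) - X) Dsum)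
    \bo hinl _ _.

Definition Bhat0 : bop H H := block_op Zhat0.
Definition Bhat1 : bop H H := block_op Zhat1.

Definition Yop (h : G) : G :=
  bop_sqrt (\id_G - Theta 0) (mp_inv (bop_sqrt (\id_G + Theta 0)) h).

(* The resolvent of [Bhat0] at [(1 - lam) / (1 + lam)]; this point is infinity
   for [lam = -1], where the resolvent is [0]. *)
Definition Bhat0_res (lam : R[i]) : bop H H :=
  if lam == -1 then 0
  else bop_inv (Bhat0 - ((1 - lam) / (1 + lam)) *: \id_H).

End HermitianContraction.

(* Main.v *)
(* Write S = Theta(0), A+ = (I + S)^(1/2) and A- = (I - S)^(1/2), so that
   A+^2 + A-^2 = 2 I. Douglas' lemma applied to I + X and I - X factors the
   off-diagonal entry of X as A+ A- Q, and the shorted operators become Schur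
   complements, whence Bhat1 - Bhat0 = 2 M M^* and Ctilde = Bhat0 + E E^* with
   M = J Q^* and E = M A-, where J embeds the entries of X into the block
   operators. By the Woodbury identity I + Theta(z) = A+ F(z)^(-1) A+ with
   F(z) = I - z E^* (I - z Bhat0)^(-1) E, so that on vectors u = A+ x, v = A+ y
   with x and y orthogonal to ker A+ the form of N(lambda) is
   2 (F(z) x, y) - (u, v) = ((I - 2 z M^* (I - z Bhat0)^(-1) M) A- x, A- y).
   For Re lambda < 0 one has |z| < 1, and then F(z) is coercive; hence the closure
   of the form lives exactly on ran A+. The isometry V comes from the polar
   decomposition of sqrt(2) M^*. *)
Require Import Defs.
From mathcomp Require Import all_boot all_order all_algebra sesquilinear.
From mathcomp Require Import complex.
From mathcomp Require Import boolp classical_sets reals.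
From mathcomp Require Import topology normedtype.
From mathcomp Require Import ring lra.

Set Implicit Arguments.
Unset Strict Implicit.
Unset Printing Implicit Defensive.

Import Order.TTheory GRing.Theory Num.Theory.
Import numFieldTopology.Exports numFieldNormedType.Exports.

Local Open Scope classical_set_scope.
Local Open Scope ring_scope.
Local Open Scope complex_scope.

(** * Real-valued norms and sequences *)

(** Neither A+ nor A- need be invertible: each may have a kernel and a range that is not closed.
    Vectors of the form domain are therefore written A+ x with x orthogonal to ker A+, where A+ is
    injective, and every factor that stands for a quotient by A+ or A- takes its values in the
    corresponding orthogonal complement. The analytic core is the coercivity of F(z). Boundedness of
    E and of the resolvent does not give it; it comes from Ctilde <= I, that is E E^* <= I - Bhat0,
    which controls E^* on the vectors (I - z Bhat0)^(-1) E x. For Ctilde and Bhat0 only the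
    numerical radius is bounded, not the norm: this suffices for the resolvents at |z| < 1 and can
    be read off the quadratic forms of the blocks. Projections, adjoints, square roots, inverses and
    shorted operators are all selected by [xget] from a specification. Nothing is known about any of
    them until an operator meeting the specification has been exhibited, and often shown unique, so
    Hilbert space theory is built here from the completeness of the space. *)

Section RealNorm.
Variable R : realType.

(* The norm of [Defs] takes its values in [R[i]]; arithmetic decision procedures
   need a totally ordered field. *)
Definition nr (V : normedZmodType R[i]) (x : V) : R := complex.Re `|x|.

Lemma nrE (V : normedZmodType R[i]) (x : V) : `|x| = (nr x)%:C.
Proof. by rewrite /nr RRe_real // normr_real. Qed.

Lemma nr_ge0 (V : normedZmodType R[i]) (x : V) : 0 <= nr x.
Proof. by rewrite -lecR -nrE normr_ge0. Qed.

Lemma nr0 (V : normedZmodType R[i]) : nr (0 : V) = 0.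
Proof. by rewrite /nr normr0. Qed.

Lemma nr_eq0 (V : normedZmodType R[i]) (x : V) : (nr x == 0) = (x == 0).
Proof. by rewrite -(inj_eq (@complexI R)) -nrE normr_eq0. Qed.

Lemma nr_gt0 (V : normedZmodType R[i]) (x : V) : (0 < nr x) = (x != 0).
Proof. by rewrite lt_neqAle nr_ge0 andbT eq_sym nr_eq0. Qed.

Lemma nr_leD (V : normedZmodType R[i]) (x y : V) : nr (x + y) <= nr x + nr y.
Proof. by rewrite -lecR rmorphD /= -!nrE ler_normD. Qed.

Lemma nrN (V : normedZmodType R[i]) (x : V) : nr (- x) = nr x.
Proof. by rewrite /nr normrN. Qed.

Lemma nr_distC (V : normedZmodType R[i]) (x y : V) : nr (x - y) = nr (y - x).
Proof. by rewrite -nrN opprB. Qed.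

Lemma nr_leB (V : normedZmodType R[i]) (x y : V) : nr (x - y) <= nr x + nr y.
Proof. by rewrite -(nrN y) nr_leD. Qed.

Lemma nr_dist_tri (V : normedZmodType R[i]) (y x z : V) :
  nr (x - z) <= nr (x - y) + nr (y - z).
Proof. by apply: le_trans (nr_leD _ _); rewrite addrA subrK. Qed.

Lemma nrZ (V : normedModType R[i]) (a : R[i]) (x : V) :
  nr (a *: x) = nr a * nr x.
Proof. by apply: (@complexI R); rewrite rmorphM /= -!nrE normrZ. Qed.

Lemma nrM (a b : R[i]) : nr (a * b) = nr a * nr b.
Proof. by apply: (@complexI R); rewrite rmorphM /= -!nrE normrM. Qed.

Lemma nrR (a : R) : 0 <= a -> nr (a%:C : R[i]) = a.
Proof. by move=> a0; rewrite /nr ger0_norm // lecR. Qed.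

Lemma nrCR (a : R) : nr (a%:C : R[i]) = `|a|.
Proof.
have [a0|a0] := leP 0 a; first by rewrite nrR // ger0_norm.
by rewrite -nrN -rmorphN nrR ?ltr0_norm // oppr_ge0 ltW.
Qed.

Lemma Re_le_nr (a : R[i]) : complex.Re a <= nr a.
Proof.
by apply: le_trans (ler_norm _) _; rewrite -lecR -nrE; exact: normc_ge_Re.
Qed.

Lemma nr_sq (a : R[i]) : nr a ^+ 2 = complex.Re a ^+ 2 + complex.Im a ^+ 2.
Proof. by apply: (@complexI R); rewrite rmorphXn /= -nrE add_Re2_Im2. Qed.

Lemma ReR (a : R) : complex.Re (a%:C) = a. Proof. by []. Qed.

Lemma ReD (a b : R[i]) : complex.Re (a + b) = complex.Re a + complex.Re b.
Proof. by case: a b => [? ?] [? ?]. Qed.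

Lemma ReN (a : R[i]) : complex.Re (- a) = - complex.Re a.
Proof. by case: a. Qed.

Lemma ReM (a b : R[i]) : complex.Re (a * b) =
  complex.Re a * complex.Re b - complex.Im a * complex.Im b.
Proof. by case: a b => [? ?] [? ?]. Qed.

Lemma ReRM (a : R) (b : R[i]) : complex.Re (a%:C * b) = a * complex.Re b.
Proof. by rewrite ReM /= mul0r subr0. Qed.

Lemma Re_conj (a : R[i]) : complex.Re (Num.conj a) = complex.Re a.
Proof. by case: a. Qed.

Lemma real_ReE (a : R[i]) : Num.conj a = a -> a = (complex.Re a)%:C.
Proof.
case: a => x y; move/eqP; rewrite eq_complex /= => /andP[_].
by rewrite eqNr => /eqP->.
Qed.

Lemma invn_lt (e : R) : 0 < e ->
  exists N : nat, forall n, (N <= n)%N -> (n.+1%:R)^-1 < e.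
Proof.
move=> e0; exists (Num.bound e^-1) => n Nn.
rewrite invf_plt ?posrE //.
have h : 0 <= e^-1 by rewrite invr_ge0 ltW.
by apply: lt_le_trans (archi_boundP h) _; rewrite ler_nat leqW.
Qed.

Lemma le_eps (a : R) : (forall e, 0 < e -> a <= e) -> a <= 0.
Proof.
move=> h; rewrite leNgt; apply/negP => a0.
by have := h (a / 2) ltac:(by rewrite divr_gt0); lra.
Qed.

Section Sequences.
Variable V : normedModType R[i].

Lemma cvg_nrP (u : nat -> V) (l : V) : u @ \oo --> l <->
  forall e : R, 0 < e -> exists N, forall n, (N <= n)%N -> nr (u n - l) < e.
Proof.
split.
  move=> /cvgrPdist_lt ul e e0; have := ul e%:C ltac:(by rewrite ltcR).
  case=> N _ Nh; exists N => n /Nh /=.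
  by rewrite nrE ltcR nr_distC.
move=> ul; apply/cvgrPdist_lt => e e0.
have er : e = (complex.Re e)%:C by rewrite RRe_real // gtr0_real.
move: e0; rewrite er ltcR => /ul[N Nh]; exists N => //= n /Nh.
by rewrite nrE ltcR nr_distC.
Qed.

Lemma lim_unique (u : nat -> V) (a b : V) :
  u @ \oo --> a -> u @ \oo --> b -> a = b.
Proof. by apply: cvg_unique; exact: norm_hausdorff. Qed.

Lemma closure_nrP (A : set V) (y : V) : closure A y <->
  forall e : R, 0 < e -> exists2 a, A a & nr (y - a) < e.
Proof.
split.
  move=> cl e e0; have ec0 : 0 < e%:C by rewrite ltcR.
  have [a [Aa]] := cl _ (nbhsx_ballx y _ ec0).
  by rewrite -ball_normE /= nrE ltcR => ya; exists a.
move=> h B /nbhs_ballP[e /= e0 eB].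
have er : e = (complex.Re e)%:C by rewrite RRe_real // gtr0_real.
move: e0; rewrite er ltcR => /h[a Aa ya]; exists a; split=> //; apply: eB.
by rewrite -ball_normE /= nrE er ltcR.
Qed.

Lemma closure_seq (A : set V) (y : V) : closure A y ->
  exists u : nat -> V, (forall n, A (u n)) /\ u @ \oo --> y.
Proof.
move=> /closure_nrP cl.
have /choice[u uh] : forall n : nat, exists a, A a /\ nr (y - a) < n.+1%:R^-1.
  by move=> n; have [|a] := cl (n.+1%:R^-1); [rewrite invr_gt0|exists a].
exists u; split; first by move=> n; have [] := uh n.
apply/cvg_nrP => e /invn_lt[N Nh]; exists N => n /Nh; apply: lt_trans.
by rewrite nr_distC; have [] := uh n.
Qed.

Lemma nr_cvg_le (u : nat -> V) (l : V) (c : R) :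
  u @ \oo --> l -> (forall n, nr (u n) <= c) -> nr l <= c.
Proof.
move=> /cvg_nrP ul uc; rewrite -subr_le0; apply: le_eps => e /ul[N Nh].
have := Nh N (leqnn _); have := uc N; have := nr_leB (u N) (u N - l).
by rewrite subKr; lra.
Qed.

End Sequences.

Lemma cauchy_nr_cvg (V : hilbertType R) (u : nat -> V) :
  (forall e : R, 0 < e -> exists N, forall n m, (N <= n)%N -> (N <= m)%N ->
     nr (u n - u m) < e) -> exists l : V, u @ \oo --> l.
Proof.
move=> uc; apply/cvg_ex; apply: cauchy_cvg; apply: cauchy_exP => e e0.
have er : e = (complex.Re e)%:C by rewrite RRe_real // gtr0_real.
move: e0; rewrite er ltcR => /uc[N Nh]; exists (u N); exists N => //= n Nn.
by rewrite -ball_normE /= nrE ltcR; exact: Nh.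
Qed.

End RealNorm.

Section InnerProduct.
Variables (R : realType) (H : hilbertType R).
Implicit Types (x y z : H) (a : R[i]).

Lemma dotDl x y z : '[x + y, z] = '[x, z] + '[y, z].
Proof. by rewrite linearDl. Qed.
Lemma dotDr x y z : '[z, x + y] = '[z, x] + '[z, y].
Proof. by rewrite linearDr. Qed.
Lemma dotNl x z : '[- x, z] = - '[x, z].
Proof. by rewrite linearNl. Qed.
Lemma dotNr x z : '[z, - x] = - '[z, x].
Proof. by rewrite linearNr. Qed.
Lemma dotBl x y z : '[x - y, z] = '[x, z] - '[y, z].
Proof. by rewrite linearBl. Qed.
Lemma dotBr x y z : '[z, x - y] = '[z, x] - '[z, y].
Proof. by rewrite linearBr. Qed.
Lemma dotZl a x z : '[a *: x, z] = a * '[x, z].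
Proof. by rewrite linearZl_LR. Qed.
Lemma dotZr a x z : '[z, a *: x] = Num.conj a * '[z, x].
Proof. by rewrite linearZr_LR. Qed.
Lemma dot0l x : '[0, x] = 0.
Proof. by rewrite linear0l. Qed.
Lemma dot0r x : '[x, 0] = 0.
Proof. by rewrite linear0r. Qed.

Definition dotE := (dotDl, dotDr, dotNl, dotNr, dotZl, dotZr, dot0l, dot0r).

Lemma dotxx x : '[x, x] = (nr x ^+ 2)%:C.
Proof. by rewrite hdotxx nrE rmorphXn. Qed.

Lemma nr_dot x y : nr '[x, y] <= nr x * nr y.
Proof. by rewrite -lecR rmorphM /= -!nrE hdot_normr_le. Qed.

Lemma dot_sum_sq x y :
  nr (x + y) ^+ 2 = nr x ^+ 2 + 2 * complex.Re '[x, y] + nr y ^+ 2.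
Proof.
rewrite -(ReR (nr (x + y) ^+ 2)) -dotxx !dotE !dotxx !ReD !ReR.
by rewrite [X in complex.Re X + _]hdotC Re_conj; ring.
Qed.

Lemma dot_sub_sq x y :
  nr (x - y) ^+ 2 = nr x ^+ 2 - 2 * complex.Re '[x, y] + nr y ^+ 2.
Proof. by rewrite dot_sum_sq dotNr ReN nrN mulrN. Qed.

Lemma parallelogram x y :
  nr (x - y) ^+ 2 = 2 * nr x ^+ 2 + 2 * nr y ^+ 2 - nr (x + y) ^+ 2.
Proof. by rewrite dot_sub_sq dot_sum_sq; ring. Qed.

Lemma dotxx_eq0 x : '[x, x] = 0 -> x = 0.
Proof. by move/eqP; rewrite hdotxx sqrf_eq0 normr_eq0 => /eqP. Qed.

Lemma dot_ext x y : (forall z, '[x, z] = '[y, z]) -> x = y.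
Proof.
by move=> h; apply/eqP; rewrite -subr_eq0; apply/eqP/dotxx_eq0; rewrite dotBl h subrr.
Qed.

Lemma dot_ext_r x y : (forall z, '[z, x] = '[z, y]) -> x = y.
Proof. by move=> h; apply: dot_ext => z; rewrite hdotC h -hdotC. Qed.

Lemma cvg_dot (u v : nat -> H) x y : u @ \oo --> x -> v @ \oo --> y ->
  (fun n => '[u n, v n]) @ \oo --> ('[x, y] : R[i]^o).
Proof.
move=> /cvg_nrP ux /cvg_nrP vy; apply/(@cvg_nrP _ R[i]^o) => e e0.
pose c := nr x + nr y + 1.
have c0 : 0 < c by rewrite /c; have := nr_ge0 x; have := nr_ge0 y; lra.
pose d := Num.min 1 (e / (2 * c)).
have d0 : 0 < d by rewrite lt_min ltr01 divr_gt0 ?mulr_gt0.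
have d1 : d <= 1 by rewrite ge_min lexx.
have dc : d * c <= e / 2.
  have -> : e / 2 = e / (2 * c) * c by field; rewrite gt_eqF.
  by rewrite ler_pM2r // ge_min lexx orbT.
have [N Nh] := ux _ d0; have [M Mh] := vy _ d0.
exists (maxn N M) => n; rewrite geq_max => /andP[/Nh un /Mh vn].
have -> : '[u n, v n] - '[x, y] = '[u n - x, v n] + '[x, v n - y].
  by rewrite dotBl dotBr addrA subrK.
apply: le_lt_trans (nr_leD _ _) _.
have h1 := nr_dot (u n - x) (v n); have h2 := nr_dot x (v n - y).
have h3 : nr (v n) <= nr y + 1.
  have := nr_leD (v n - y) y; rewrite subrK; lra.
have hx := nr_ge0 x; have hy := nr_ge0 y.
have h4 : nr (u n - x) * nr (v n) <= d * (nr y + 1).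
  by apply: ler_pM; rewrite ?nr_ge0 // ltW.
have h5 : nr x * nr (v n - y) <= nr x * d by rewrite ler_wpM2l // ltW.
by move: dc; rewrite /c; nra.
Qed.

End InnerProduct.

(** * Bounded operators, projections and adjoints *)

Section Bounded.
Variables (R : realType) (U V : hilbertType R).

Lemma bop_bound (T : bop U V) :
  exists2 c : R, 0 < c & forall x, nr (T x) <= c * nr x.
Proof.
have /linear_boundedP[M [Mr Mh]] : bounded_near (bop_fun T) (nbhs (0 : U)).
  by apply: continuous_linear_bounded; exact: bop_continuous.
have c0 : 0 < 1 + `|M| by rewrite ltr_pwDl.
have cE : 1 + `|M| = (1 + nr M)%:C by rewrite nrE rmorphD rmorph1.
exists (1 + nr M); first by rewrite -ltcR -cE.
move=> x; rewrite -lecR rmorphM /= -!nrE -cE; apply: Mh.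
by apply: le_lt_trans (real_ler_norm Mr) _; rewrite ltrDr.
Qed.

Lemma bop_of_bound (f : U -> V) (c : R) :
  linear f -> (forall x, nr (f x) <= c * nr x) ->
  exists T : bop U V, forall x, T x = f x.
Proof.
move=> fl fc.
have fcont : continuous f.
  move=> x; apply/cvgrPdist_lt => e e0.
  have er : e = (complex.Re e)%:C by rewrite RRe_real // gtr0_real.
  have e1 : 0 < complex.Re e by rewrite -ltcR -er.
  have c0 : 0 < 1 + `|c| by rewrite ltr_pwDl.
  have d0 : 0 < (complex.Re e / (1 + `|c|))%:C by rewrite ltcR divr_gt0.
  near=> y.
  have fB : f x - f y = f (x - y).
    have := fl (-1) y x; rewrite !scaleN1r addrC [X in f X]addrC => ->.
    by rewrite addrC.
  rewrite fB nrE er ltcR.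
  have xy : nr (x - y) < complex.Re e / (1 + `|c|).
    by rewrite -ltcR -nrE; near: y; exact: (@cvgr_dist_lt _ _ _ _ _ id x).
  move: xy; rewrite ltr_pdivlMr // => xy.
  apply: le_lt_trans (fc _) (le_lt_trans _ xy).
  rewrite mulrC ler_wpM2l ?nr_ge0 //.
  by apply: le_trans (ler_norm _) _; rewrite lerDr.
by exists (BOp fl fcont).
Unshelve. all: by end_near.
Qed.

Lemma bop_cvg (T : bop U V) (u : nat -> U) (x : U) :
  u @ \oo --> x -> (fun n => T (u n)) @ \oo --> T x.
Proof. by move=> ux; apply: continuous_cvg => //; exact: bop_continuous. Qed.

End Bounded.

Section Projection.
Variables (R : realType) (H : hilbertType R) (K : csubspace H).

Lemma cset_csval (k : csub K) : cset K (csval k).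
Proof. by have := csvalP k; rewrite inE. Qed.

Lemma csub_of (x : H) : cset K x -> exists k : csub K, csval k = x.
Proof.
move=> Kx; have Kx' : x \in cpred K by rewrite inE.
by exists (CSub Kx').
Qed.

Lemma csvalD (k l : csub K) : csval (k + l) = csval k + csval l. Proof. by []. Qed.
Lemma csvalB (k l : csub K) : csval (k - l) = csval k - csval l. Proof. by []. Qed.
Lemma csvalZ a (k : csub K) : csval (a *: k) = a *: csval k. Proof. by []. Qed.

Definition csvalE := (csvalD, csvalB, csvalZ).

Lemma csval_dot (k l : csub K) : '[k, l] = '[csval k, csval l].
Proof. by []. Qed.

Lemma csval_nr (k : csub K) : nr k = nr (csval k).
Proof. by []. Qed.

(* Minimising sequences for the distance from [x] to [K] are Cauchy by the
   parallelogram law. *)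
Lemma projection_exists (x : H) :
  exists k : csub K, forall v, cset K v -> '[x - csval k, v] = 0.
Proof.
pose E := [set r : R | exists k : csub K, r = nr (x - csval k) ^+ 2].
have hE : has_inf E.
  split; first by exists (nr (x - csval (0 : csub K)) ^+ 2), 0.
  by exists 0 => _ [k ->]; rewrite exprn_ge0 // nr_ge0.
pose d := inf E.
have dle (k : csub K) : d <= nr (x - csval k) ^+ 2.
  by apply: ge_inf; [case: hE|exists k].
have /choice[u uh] : forall n : nat, exists k : csub K,
    nr (x - csval k) ^+ 2 < d + n.+1%:R^-1.
  move=> n; have [|_ [k ->] ek] := @inf_adherent _ E (n.+1%:R^-1) _ hE.
    by rewrite invr_gt0.
  by exists k.
have [k uk] : exists k : csub K, u @ \oo --> k.
  apply: cauchy_nr_cvg => e e0.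
  have [N Nh] := @invn_lt R (e ^+ 2 / 4) ltac:(by rewrite divr_gt0 ?exprn_gt0).
  exists N => n m /Nh Nn /Nh Nm.
  rewrite -(ltr_pXn2r (n := 2)) ?nnegrE ?nr_ge0 ?ltW // csval_nr csvalB.
  have -> : csval (u n) - csval (u m) = (x - csval (u m)) - (x - csval (u n)).
    by rewrite opprB [RHS]addrC addrA subrK.
  rewrite parallelogram.
  have -> : (x - csval (u m)) + (x - csval (u n)) =
            2 *: (x - csval (2^-1 *: (u m + u n))).
    rewrite !csvalE scalerBr scalerA divff ?pnatr_eq0 // scale1r.
    by rewrite scaler_nat mulr2n opprD addrACA.
  have -> y : nr (2 *: y : H) ^+ 2 = 4 * nr y ^+ 2.
    have -> : (2 : R[i]) = 2%:C by rewrite rmorph_nat.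
    by rewrite nrZ nrR // exprMn; congr (_ * _); rewrite -natrX.
  have := dle (2^-1 *: (u m + u n)); have := uh n; have := uh m.
  by move: Nn Nm; move: (n.+1%:R^-1) (m.+1%:R^-1) => i j; lra.
exists k => v Kv; apply/eqP; rewrite -nr_eq0 eq_le nr_ge0 andbT.
have [->|v0] := eqVneq v 0; first by rewrite dot0r nr0.
have nv : 0 < nr v by rewrite nr_gt0.
have step n : nr '[x - csval (u n), v] ^+ 2 <= n.+1%:R^-1 * nr v ^+ 2.
  have [w wv] := csub_of Kv.
  (* Moving [u n] along [v] with the optimal coefficient [t] lowers the squared distance by |(r,
     v)|^2 / |v|^2. As [u n] is already within 1/(n+1) of the infimum, this gain is at most
     1/(n+1). *)
  pose r := x - csval (u n); pose t := '[r, v] / '[v, v].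
  have nvC : '[v, v] != 0 by rewrite dotxx eq_complex /= sqrf_eq0 gt_eqF.
  have := dle (u n + t *: w); rewrite !csvalE wv opprD addrA -/r.
  have -> : nr (r - t *: v) ^+ 2 = nr r ^+ 2 - nr '[r, v] ^+ 2 / nr v ^+ 2.
    have vC : Num.conj '[v, v] = '[v, v] by rewrite -hdotC.
    have ta : complex.Re (Num.conj t * '[r, v]) = nr '[r, v] ^+ 2 / nr v ^+ 2.
      rewrite /t rmorphM fmorphV /= vC mulrAC [Num.conj _ * _]mulrC -normCK nrE.
      by rewrite dotxx -rmorphXn -fmorphV -rmorphM ReR.
    have tn : nr t = nr '[r, v] / nr v ^+ 2.
      rewrite /t nrM dotxx -fmorphV nrR // invr_ge0 exprn_ge0 //.
      exact: nr_ge0.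
    rewrite dot_sub_sq dotZr ta nrZ tn; field.
    by rewrite gt_eqF.
  have := uh n; rewrite -/r; set a := nr '[r, v]; set b := nr r.
  move=> h1 h2.
  have : a ^+ 2 / nr v ^+ 2 <= n.+1%:R^-1.
    by move: h1 h2; move: (n.+1%:R^-1) (a ^+ 2 / _) => i j; lra.
  by rewrite ler_pdivrMr // exprn_gt0.
apply: le_eps => e e0.
pose e' := e / (2 * nr v); have e'0 : 0 < e' by rewrite divr_gt0 ?mulr_gt0.
have e'E : e' * nr v = e / 2 by rewrite /e'; field; rewrite gt_eqF.
have [N Nh] := (cvg_nrP _ _).1 uk _ e'0.
have [M Mh] := invn_lt (exprn_gt0 2 e'0).
pose n := maxn N M.
have -> : '[x - csval k, v] = '[x - csval (u n), v] + '[csval (u n - k), v].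
  by rewrite -dotDl csvalB addrA subrK.
apply: le_trans (nr_leD _ _) _.
have h1 : nr '[csval (u n - k), v] <= e / 2.
  apply: le_trans (nr_dot _ _) _; rewrite -e'E ler_pM2r // ltW //.
  by apply: Nh; rewrite leq_maxl.
have h2 : nr '[x - csval (u n), v] <= e / 2.
  rewrite -(ler_pXn2r (n := 2)) ?nnegrE ?nr_ge0 ?divr_ge0 ?(ltW e0) //.
  apply: le_trans (step n) _; rewrite -e'E exprMn ler_pM2r ?exprn_gt0 // ltW //.
  by apply: Mh; rewrite leq_maxr.
by move: h1 h2; lra.
Qed.

Lemma projection_unique (x : H) (k l : csub K) :
  (forall v, cset K v -> '[x - csval k, v] = 0) ->
  (forall v, cset K v -> '[x - csval l, v] = 0) -> k = l.
Proof.
move=> hk hl; apply/eqP; rewrite -subr_eq0; apply/eqP/dotxx_eq0.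
have -> : '[k - l, k - l] = '[x - csval l, csval (k - l)] - '[x - csval k, csval (k - l)].
  by rewrite -dotBl opprB [_ - csval l]addrC addrACA subrr addr0 addrC csval_dot.
by rewrite hk ?hl ?subrr //; exact: cset_csval.
Qed.

(** The nearest points form a linear map by uniqueness and a contractive one by Pythagoras. This
    provides the bounded operator that [xget] needs in the definition of [cproj]. *)
Lemma cprojP (x v : H) : cset K v -> '[x - csval (cproj K x), v] = 0.
Proof.
move: x v; have [f fP] := choice projection_exists.
have fl : linear f.
  move=> a x y; apply: (@projection_unique (a *: x + y)); first exact: fP.
  move=> v Kv; rewrite !csvalE opprD addrACA -scalerBr dotDl dotZl.
  by rewrite !fP // mulr0 addr0.
have fb x : nr (f x) <= 1 * nr x.
  rewrite mul1r -(ler_pXn2r (n := 2)) ?nnegrE ?nr_ge0 // csval_nr.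
  have {2}-> : x = (x - csval (f x)) + csval (f x) by rewrite subrK.
  rewrite [leRHS]dot_sum_sq fP; last exact: cset_csval.
  by rewrite mulr0 addr0 lerDr exprn_ge0 // nr_ge0.
have [P PE] := bop_of_bound fl fb.
suff : forall x k, cset K k -> '[x - csval (cproj K x), k] = 0 by [].
apply: (@xgetI _ 0 [set P : bop H (csub K) |
  forall x k, cset K k -> '[x - csval (P x), k] = 0] P) => /= x k Kk.
by rewrite PE fP.
Qed.

Lemma cprojE (x : H) (k : csub K) :
  (forall v, cset K v -> '[x - csval k, v] = 0) -> cproj K x = k.
Proof. by move=> h; apply: (projection_unique _ h) => v; exact: cprojP. Qed.

Lemma cproj_id (k : csub K) : cproj K (csval k) = k.
Proof. by apply: cprojE => v _; rewrite subrr dot0l. Qed.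

Lemma cproj_adj (x : H) (k : csub K) : '[cproj K x, k] = '[x, csval k].
Proof.
apply/eqP; rewrite eq_sym -subr_eq0 csval_dot -dotBl cprojP //.
exact: cset_csval.
Qed.

End Projection.

Section Adjoint.
Variables (R : realType) (U V : hilbertType R).

Let kernel_submod (f : U -> R[i]) : (forall a x y, f (a *: x + y) = a * f x + f y) ->
  GRing.submod_closed [pred x | x \in [set x | f x = 0]].
Proof.
move=> fl; split.
  have := fl 0 0 0; rewrite scale0r mul0r !add0r => _.
  have := fl 1 0 0; rewrite scale1r mul1r addr0 inE /= => /eqP.
  by rewrite -subr_eq0 opprD addrA subrr sub0r oppr_eq0 => /eqP.
by move=> a x y; rewrite !inE /= => fx fy; rewrite fl fx fy mulr0 addr0.
Qed.

(** The kernel of f is a closed subspace. If f is not zero, the component r of some vector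
    orthogonal to the kernel represents f up to a scalar, because f(r) x - f(x) r lies in the kernel
    and hence is orthogonal to r. *)
Lemma riesz (f : U -> R[i]) (c : R) :
  (forall a x y, f (a *: x + y) = a * f x + f y) ->
  (forall x, nr (f x) <= c * nr x) -> exists s, forall x, f x = '[x, s].
Proof.
move=> fl fb.
have fB x y : f (x - y) = f x - f y.
  by rewrite addrC -scaleN1r fl mulN1r addrC.
have kcl : closed [set x | f x = 0].
  move=> x /closure_nrP xcl /=; apply/eqP; rewrite -nr_eq0 eq_le nr_ge0 andbT.
  apply: le_eps => e e0.
  have c0 : 0 < 1 + `|c| by rewrite ltr_pwDl.
  have [y /= y0 xy] := xcl (e / (1 + `|c|)) ltac:(by rewrite divr_gt0).
  move: xy; rewrite ltr_pdivlMr // => xy.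
  rewrite -[f x]subr0 -y0 -fB; apply: le_trans (fb _) (le_trans _ (ltW xy)).
  rewrite mulrC ler_wpM2l ?nr_ge0 //.
  by apply: le_trans (ler_norm _) _; rewrite lerDr.
pose K := CSubspace kcl (kernel_submod fl).
have [[x0 /eqP fx0]|h] := pselect (exists x, f x <> 0); last first.
  exists 0 => x; rewrite dot0r; apply: contrapT => fx.
  by apply: h; exists x.
have f0 : f 0 = 0 by rewrite -(subrr 0) fB subrr.
pose r := x0 - csval (cproj K x0).
have fr : f r = f x0.
  by rewrite fB (_ : f (csval _) = 0) ?subr0 //; exact: (cset_csval (cproj K x0)).
have rn0 : r != 0 by apply: contraNneq fx0 => r0; rewrite -fr r0 f0.
have rr0 : '[r, r] != 0 by apply: contraNneq rn0 => /dotxx_eq0 ->.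
exists (Num.conj (f r / '[r, r]) *: r) => x.
rewrite dotZr conjCK.
have : '[r, f r *: x - f x *: r] = 0.
  apply: cprojP => /=.
  have fZ a y : f (a *: y) = a * f y by rewrite -[a *: y]addr0 fl f0 addr0.
  by rewrite fB !fZ mulrC subrr.
move/(congr1 (@Num.conj R[i])); rewrite -hdotC dotBl !dotZl rmorph0 => /eqP.
rewrite subr_eq0 => /eqP h.
by rewrite mulrAC h mulfK.
Qed.

Lemma adj_exists (T : bop U V) : exists S : bop V U, forall x y, '[T x, y] = '[x, S y].
Proof.
have [c c0 Tc] := bop_bound T.
have /choice[s sh] : forall y, exists z, forall x, '[T x, y] = '[x, z].
  move=> y; apply: (@riesz (fun x => '[T x, y]) (c * nr y)).
    by move=> a x z; rewrite linearP dotDl dotZl.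
  move=> x; apply: le_trans (nr_dot _ _) _.
  by rewrite mulrAC ler_wpM2r ?nr_ge0.
have sl : linear s.
  move=> a y z; apply: dot_ext_r => x.
  by rewrite -sh !dotDr !dotZr !sh.
have [x|S SE] := bop_of_bound (c := c) sl.
  have [->|s0] := eqVneq (s x) 0; first by rewrite nr0 mulr_ge0 ?nr_ge0 // ltW.
  (* The bound on [s] comes from |s x|^2 = (T (s x), x) <= c |s x| |x|. *)
  rewrite -(ler_pM2l (x := nr (s x))) ?nr_gt0 // -expr2.
  rewrite -(ReR (nr (s x) ^+ 2)) -dotxx -sh.
  apply: le_trans (Re_le_nr _) (le_trans (nr_dot _ _) _).
  by rewrite mulrA ler_wpM2r ?nr_ge0 // mulrC Tc.
by exists S => x y; rewrite SE sh.
Qed.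

Lemma adjP (T : bop U V) x y : '[T x, y] = '[x, adj T y].
Proof.
have [S ST] := adj_exists T.
move: x y.
exact: (@xgetI _ 0 [set S : bop V U | forall x y, '[T x, y] = '[x, S y]] S).
Qed.

Lemma adjPr (T : bop U V) x y : '[y, T x] = '[adj T y, x].
Proof. by rewrite hdotC adjP -hdotC. Qed.

Lemma adjE (T : bop U V) (S : bop V U) :
  (forall x y, '[T x, y] = '[x, S y]) -> adj T = S.
Proof.
by move=> h; apply: bop_ext => y; apply: dot_ext_r => x; rewrite -adjP h.
Qed.

End Adjoint.

Section Operators.
Variables (R : realType).
Implicit Types U V W : hilbertType R.

Lemma bopD U V (T : bop U V) x y : T (x + y) = T x + T y.
Proof. exact: linearD. Qed.
Lemma bopB U V (T : bop U V) x y : T (x - y) = T x - T y.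
Proof. exact: linearB. Qed.
Lemma bopN U V (T : bop U V) x : T (- x) = - T x.
Proof. exact: linearN. Qed.
Lemma bopZ U V (T : bop U V) a x : T (a *: x) = a *: T x.
Proof. exact: linearZ. Qed.
Lemma bop0 U V (T : bop U V) : T 0 = 0.
Proof. exact: linear0. Qed.

Definition bopE := (bopD, bopB, bopN, bopZ, bop0).

Lemma bop_addE U V (S T : bop U V) x : (S + T) x = S x + T x. Proof. by []. Qed.
Lemma bop_oppE U V (T : bop U V) x : (- T) x = - T x. Proof. by []. Qed.
Lemma bop_subE U V (S T : bop U V) x : (S - T) x = S x - T x. Proof. by []. Qed.
Lemma bop_scaleE U V a (T : bop U V) x : (a *: T) x = a *: T x. Proof. by []. Qed.
Lemma bop_compE U V W (S : bop V W) (T : bop U V) x : (S \bo T) x = S (T x).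
Proof. by []. Qed.
Lemma bop_idE U (x : U) : (\id_U) x = x. Proof. by []. Qed.
Lemma bop_zeroE U V (x : U) : (0 : bop U V) x = 0. Proof. by []. Qed.

Definition appE := (bop_addE, bop_subE, bop_oppE, bop_scaleE, bop_compE,
  bop_idE, bop_zeroE).

Lemma adj_adj U V (T : bop U V) : adj (adj T) = T.
Proof. by apply: adjE => x y; rewrite -adjPr. Qed.

Lemma adj_comp U V W (S : bop V W) (T : bop U V) : adj (S \bo T) = adj T \bo adj S.
Proof. by apply: adjE => x y; rewrite !appE !adjP. Qed.

Lemma adj_sa U (T : bop U U) : selfadjoint T -> adj T = T.
Proof. exact: adjE. Qed.

Lemma adj_cproj U (K : csubspace U) : adj (cproj K) = cincl K.
Proof. by apply: adjE => x y; rewrite cproj_adj. Qed.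

(** The inequality makes A x -> T x well defined and Lipschitz on the range of A; completeness of W
    carries it to the closure. Inverses, Douglas factors and polar isometries are all obtained from
    this extension. *)
Lemma extension U V W (A : bop U V) (T : bop U W) (c : R) :
  (forall x, nr (T x) <= c * nr (A x)) ->
  exists S : bop (csub (ran_closure A)) W,
    forall x y, csval y = A x -> S y = T x.
Proof.
move=> TA'.
(* The constant [c] has no prescribed sign, whereas the estimates below divide by it. *)
pose C := 1 + `|c|; have C0 : 0 < C by rewrite ltr_pwDl.
have TA x : nr (T x) <= C * nr (A x).
  apply: le_trans (TA' _) _; rewrite ler_wpM2r ?nr_ge0 //.
  by apply: le_trans (ler_norm _) _; rewrite lerDr.
have cT (u : nat -> U) (y : V) : (fun n => A (u n)) @ \oo --> y ->
    exists z : W, (fun n => T (u n)) @ \oo --> z.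
  move/cvg_nrP => Au; apply: cauchy_nr_cvg => e e0.
  have [N Nh] := Au (e / C / 2) ltac:(by rewrite !divr_gt0).
  exists N => n m /Nh hn /Nh hm; rewrite -bopB.
  apply: le_lt_trans (TA _) _.
  have : nr (A (u n - u m)) < e / C.
    rewrite bopB; apply: le_lt_trans (nr_dist_tri y _ _) _.
    by rewrite [nr (y - _)]nr_distC; lra.
  by rewrite ltr_pdivlMr // mulrC.
have uT (u v : nat -> U) (y : V) (z : W) : (fun n => A (u n)) @ \oo --> y ->
    (fun n => A (v n)) @ \oo --> y -> (fun n => T (u n)) @ \oo --> z ->
    (fun n => T (v n)) @ \oo --> z.
  move=> /cvg_nrP Au /cvg_nrP Av /cvg_nrP Tu; apply/cvg_nrP => e e0.
  have d0 : 0 < e / C / 4 by rewrite !divr_gt0.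
  have [N1 h1] := Au _ d0; have [N2 h2] := Av _ d0.
  have [N3 h3] := Tu (e / 2) ltac:(by rewrite divr_gt0).
  exists (maxn N1 (maxn N2 N3)) => n; rewrite !geq_max.
  move=> /andP[/h1 un /andP[/h2 vn /h3 zn]].
  apply: le_lt_trans (nr_dist_tri (T (u n)) _ _) _.
  rewrite -bopB; have := TA (v n - u n).
  have : C * nr (A (v n - u n)) < e / 2.
    rewrite mulrC -ltr_pdivlMr // bopB.
    apply: le_lt_trans (nr_dist_tri y _ _) _; rewrite [nr (y - _)]nr_distC.
    have -> : e / 2 / C = (e / C / 4) * 2 by field; rewrite gt_eqF.
    by lra.
  by move: zn; lra.
have /choice[f fP] : forall y : csub (ran_closure A), exists z : W,
    forall u : nat -> U, (fun n => A (u n)) @ \oo --> csval y ->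
      (fun n => T (u n)) @ \oo --> z.
  move=> y; have [v [vr vy]] := closure_seq (cset_csval y).
  have /choice[u uv] : forall n, exists x, A x = v n.
    by move=> n; have [x _ xv] := vr n; exists x.
  have Au : (fun n => A (u n)) @ \oo --> csval y by under eq_fun do rewrite uv.
  have [z uz] := cT _ _ Au.
  by exists z => w Aw; exact: uT Au Aw uz.
have approx (y : csub (ran_closure A)) : exists u : nat -> U,
    (fun n => A (u n)) @ \oo --> csval y.
  have [v [vr vy]] := closure_seq (cset_csval y).
  have /choice[u uv] : forall n, exists x, A x = v n.
    by move=> n; have [x _ xv] := vr n; exists x.
  by exists u; under eq_fun do rewrite uv.
have fl : linear f.
  move=> a y z; have [u uy] := approx y; have [v vz] := approx z.
  have h : (fun n => A (a *: u n + v n)) @ \oo --> csval (a *: y + z).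
    under eq_fun do rewrite bopD bopZ.
    by rewrite !csvalE; apply: cvgD => //; exact: cvgZl_tmp.
  apply: lim_unique (fP _ _ h) _.
  under eq_fun do rewrite bopD bopZ.
  by apply: cvgD; [apply: cvgZl_tmp|]; exact: fP.
have fb y : nr (f y) <= C * nr y.
  have [u uy] := approx y; have := fP _ _ uy; move: uy.
  move=> /cvg_nrP uy /cvg_nrP fy; rewrite -subr_le0; apply: le_eps => e e0.
  have [N Nh] := uy (e / C / 2) ltac:(by rewrite !divr_gt0).
  have [M Mh] := fy (e / 2) ltac:(by rewrite divr_gt0).
  have := Nh _ (leq_maxl N M); have := Mh _ (leq_maxr N M).
  set x := u _ => hT hA.
  have h1 : nr (f y) <= nr (T x) + e / 2.
    have := nr_leB (T x) (T x - f y); rewrite subKr; lra.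
  have h2 : nr (A x) <= nr y + e / C / 2.
    by have := nr_leD (A x - csval y) (csval y); rewrite subrK csval_nr; lra.
  have h3 : C * nr (A x) <= C * nr y + e / 2.
    have -> : C * nr y + e / 2 = C * (nr y + e / C / 2) by field; rewrite gt_eqF.
    by rewrite ler_pM2l.
  by have := TA x; lra.
have [S SE] := bop_of_bound fl fb.
exists S => x y yx; rewrite SE.
apply: (@lim_unique R W (fun=> T x)); last exact: cvg_cst.
by apply: fP; rewrite yx; exact: cvg_cst.
Qed.

Lemma ran_closureP U V (T : bop U V) x : cset (ran_closure T) (T x).
Proof. by apply: subset_closure; exists x. Qed.

Lemma cproj_ran U V (T : bop U V) x : csval (cproj (ran_closure T) (T x)) = T x.
Proof.
by have [k <-] := csub_of (@ran_closureP U V T x); rewrite cproj_id.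
Qed.

(** The residual of y after projection onto the closed range is orthogonal to that range, so it lies
    in the kernel of the adjoint; orthogonality of y to it then makes it vanish. *)
Lemma ran_ortho_ker U V (T : bop U V) y :
  (forall k, adj T k = 0 -> '[y, k] = 0) -> closure (range T) y.
Proof.
move=> h; set P := cproj (ran_closure T).
suff -> : y = csval (P y) by exact: (cset_csval (P y)).
apply/eqP; rewrite -subr_eq0; apply/eqP/dotxx_eq0; rewrite dotBr.
rewrite (cprojP _ (cset_csval (P y))) subr0.
rewrite hdotC h ?rmorph0 //; apply: dot_ext => x.
by rewrite dot0l -adjPr cprojP //; exact: ran_closureP.
Qed.

Definition coercive U (T : bop U U) :=
  exists2 c : R, 0 < c & forall x, c * nr x ^+ 2 <= nr '[T x, x].

(** This is the Lax-Milgram argument: coercivity bounds T from below, so the inverse extends from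
    the range to its closure, and a vector of ker T^* has (T k, k) = 0, so the range is dense. *)
Lemma coercive_inv U (T : bop U U) : coercive T ->
  exists S : bop U U, S \bo T = \id_U /\ T \bo S = \id_U.
Proof.
move=> [c c0 Tc].
have Tb x : nr (\id_U x) <= c^-1 * nr (T x).
  rewrite appE mulrC ler_pdivlMr //; have [->|x0] := eqVneq x 0.
    by rewrite bop0 !nr0 mul0r.
  rewrite -(ler_pM2r (x := nr x)) ?nr_gt0 //.
  by apply: le_trans (nr_dot _ _); apply: le_trans (Tc x); rewrite expr2 mulrCA mulrA.
have [S SE] := extension Tb.
have full y : closure (range T) y.
  apply: ran_ortho_ker => k k0.
  have : '[T k, k] = 0 by rewrite adjP k0 dot0r.
  move=> h; have := Tc k; rewrite h nr0 pmulr_rle0 // => k2.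
  have -> : k = 0.
    by apply/eqP; rewrite -nr_eq0 -sqrf_eq0 eq_le k2 exprn_ge0 // nr_ge0.
  by rewrite dot0r.
have PE y : csval (cproj (ran_closure T) y) = y.
  by have [k <-] := csub_of (full y : cset (ran_closure T) y); rewrite cproj_id.
exists (S \bo cproj (ran_closure T)); split; apply: bop_ext => x; rewrite !appE.
  by apply: SE; rewrite PE.
have [u [ur ux]] := closure_seq (full x).
apply: (@lim_unique R U u) => //.
have := bop_cvg (T := T) (bop_cvg (T := S) (bop_cvg (T := cproj (ran_closure T)) ux)).
suff -> : (fun n => T (S (cproj (ran_closure T) (u n)))) = u by [].
by apply/funext => n; have [z _ <-] := ur n; rewrite (SE z) ?PE // appE.
Qed.

Lemma bop_invE U (T S : bop U U) :
  S \bo T = \id_U -> T \bo S = \id_U -> bop_inv T = S.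
Proof.
move=> ST TS; apply: xget_unique => // S' [S'T TS'].
apply: bop_ext => x; have := congr1 (fun F : bop U U => F (S x)) S'T.
have := congr1 (fun F : bop U U => F x) TS.
by rewrite !appE => ->.
Qed.

Lemma bop_invP U (T : bop U U) : coercive T ->
  (forall x, bop_inv T (T x) = x) /\ (forall x, T (bop_inv T x) = x).
Proof.
move=> /coercive_inv[S [ST TS]]; rewrite (bop_invE ST TS).
by split => x; [rewrite -{2}(bop_idE x) -ST|rewrite -{2}(bop_idE x) -TS].
Qed.

End Operators.

(** * Square roots of nonnegative operators *)

Section SelfAdjoint.
Variables (R : realType) (H : hilbertType R).
Implicit Types T S : bop H H.

(** Nonnegativity in [R[i]] includes reality, so the sesquilinear form (T u, v) - (u, T v) vanishes
    on the diagonal. Polarization with y and with i y makes it vanish everywhere. *)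
Lemma nonneg_selfadjoint T : op_nonneg T -> selfadjoint T.
Proof.
move=> T0 x y; apply/eqP; rewrite -subr_eq0; apply/eqP.
pose B u v := '[T u, v] - '[u, T v].
have Bd z : B z z = 0.
  have rz : '[T z, z] \is Num.real by apply: ger0_real; exact: T0.
  by rewrite /B [X in _ - X]hdotC (CrealP rz) subrr.
have h1 : B x y + B y x = 0.
  have : B (x + y) (x + y) = B x x + B y y + (B x y + B y x).
    by rewrite /B bopD !dotE; ring.
  by rewrite !Bd !add0r => <-.
have h2 : 'i * (B y x - B x y) = 0.
  have : B (x + 'i *: y) (x + 'i *: y) =
         B x x + ('i * - 'i) * B y y + 'i * (B y x - B x y).
    by rewrite /B bopD bopZ !dotE conjCi; ring.
  by rewrite !Bd mulr0 !add0r => <-.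
move/eqP: h2; rewrite mulf_eq0 (negPf (neq0Ci _)) /= subr_eq0 => /eqP h2.
by move: h1; rewrite h2 -mulr2n => /eqP; rewrite mulrn_eq0 => /eqP.
Qed.

Lemma sa_dotE T x : selfadjoint T -> '[T x, x] = (complex.Re '[T x, x])%:C.
Proof. by move=> Tsa; apply: real_ReE; rewrite -hdotC -Tsa. Qed.

Lemma nonnegP T :
  op_nonneg T <-> selfadjoint T /\ forall x, 0 <= complex.Re '[T x, x].
Proof.
split=> [T0|[Tsa T0] x]; last by rewrite sa_dotE // lecR.
split; first exact: nonneg_selfadjoint.
by move=> x; have := T0 x; rewrite lecE => /andP[].
Qed.

Lemma dotZrR (a : R) (x y : H) : '[x, a%:C *: y] = a%:C * '[x, y].
Proof. by rewrite dotZr; congr (_ * _); apply/CrealP; rewrite complex_real. Qed.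

Lemma contractive_nrP (U V : hilbertType R) (T : bop U V) :
  contractive T <-> forall x, nr (T x) <= nr x.
Proof. by split=> h x; [rewrite -lecR -!nrE|rewrite !nrE lecR]. Qed.

(** * The square root of I - A for a contraction A *)

Section Iteration.
Variable A : bop H H.
Hypothesis A_contr : forall x, nr (A x) <= nr x.

(* [NN T c]: [T] is a polynomial in [A] with nonnegative coefficients, whose
   value at [A = 1] is [c]. *)
Inductive NN : bop H H -> R -> Prop :=
| NN_base : NN A 1
| NN_zero : NN 0 0
| NN_add S T s t of NN S s & NN T t : NN (S + T) (s + t)
| NN_comp S T s t of NN S s & NN T t : NN (S \bo T) (s * t)
| NN_scale T t r of 0 <= r & NN T t : NN (r%:C *: T) (r * t).

Lemma NN_ge0 T t : NN T t -> 0 <= t.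
Proof.
by elim=> {T t} [||S T s t _ s0 _ t0|S T s t _ s0 _ t0|T t r r0 _ t0];
  rewrite ?ler01 ?addr_ge0 ?mulr_ge0.
Qed.

Lemma NN_bound T t : NN T t -> forall x, nr (T x) <= t * nr x.
Proof.
elim=> {T t} [x|x|S T s t _ hS _ hT x|S T s t nS hS nT hT x|T t r r0 _ hT x].
- by rewrite mul1r.
- by rewrite nr0 mul0r.
- by apply: le_trans (nr_leD _ _) _; rewrite mulrDl lerD.
- apply: le_trans (hS _) _; rewrite -mulrA ler_wpM2l //.
  exact: NN_ge0 nS.
- by rewrite appE nrZ nrR // -mulrA ler_wpM2l.
Qed.

Lemma NN_comm T t (C : bop H H) : NN T t -> (forall x, C (A x) = A (C x)) ->
  forall x, C (T x) = T (C x).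
Proof.
move=> nT CA.
elim: nT => {T t} [||S T s t _ hS _ hT x|S T s t nS hS nT hT x|T t r r0 _ hT x];
  rewrite ?appE //.
- by move=> x; rewrite !appE bop0.
- by rewrite bopD hS hT.
- by rewrite hS hT.
- by rewrite bopZ hT.
Qed.

Lemma NN_sa T t : NN T t -> selfadjoint A -> selfadjoint T.
Proof.
move=> nT Asa.
elim: nT => {T t} [||S T s t _ hS _ hT|S T s t nS hS nT hT|T t r r0 _ hT] // x y;
  rewrite !appE.
- by rewrite dot0l dot0r.
- by rewrite dotDl dotDr hS hT.
- rewrite hS hT; congr ('[x, _]); apply/esym.
  by apply: (NN_comm nT) => z; apply/esym; exact: (NN_comm nS).
- by rewrite dotZl dotZr hT; congr (_ * _); apply/esym/CrealP; rewrite ger0_real ?lecR.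
Qed.

(** The operator Y = I - (I - A)^(1/2) is a fixed point of Y = (A + Y^2) / 2, and this is its
    iteration from 0. The scalar sequence [sqy] is the same iteration at A = 1; it increases, stays
    below 1, and dominates the operator sequence. *)
Fixpoint sqY n : bop H H :=
  if n is m.+1 then (2^-1)%:C *: (A + sqY m \bo sqY m) else 0.

Fixpoint sqy n : R := if n is m.+1 then 2^-1 * (1 + sqy m * sqy m) else 0.

Lemma NN_sqY n : NN (sqY n) (sqy n).
Proof.
elim: n => [|n IH] /=; first exact: NN_zero.
apply: NN_scale; first by rewrite invr_ge0.
by apply: NN_add; [exact: NN_base|exact: NN_comp].
Qed.

(** The iterates commute, so each increment is half the product of the preceding increment with the
    sum of the two iterates it separates. Nonnegative coefficients are thus preserved, and the norms
    of operator increments are controlled by the scalar ones. *)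
Lemma NN_sqY_step n : NN (sqY n.+1 - sqY n) (sqy n.+1 - sqy n).
Proof.
elim: n => [|n IH].
  rewrite /= !subr0 mulr0 addr0.
  have -> : (0 : bop H H) \bo (0 : bop H H) = 0 by apply: bop_ext => x.
  rewrite addr0; apply: NN_scale; first by rewrite invr_ge0.
  exact: NN_base.
have -> : sqy n.+2 - sqy n.+1 =
    2^-1 * ((sqy n.+1 - sqy n) * (sqy n.+1 + sqy n)).
  have e k : sqy k.+1 = 2^-1 * (1 + sqy k * sqy k) by [].
  by rewrite (e n.+1) (e n); ring.
have -> : sqY n.+2 - sqY n.+1 =
    (2^-1)%:C *: ((sqY n.+1 - sqY n) \bo (sqY n.+1 + sqY n)).
  have cm x : sqY n (sqY n.+1 x) = sqY n.+1 (sqY n x).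
    apply: (NN_comm (NN_sqY n.+1)) => z; apply/esym.
    exact: (NN_comm (NN_sqY n)).
  have -> : sqY n.+2 - sqY n.+1 = (2^-1)%:C *: (A + sqY n.+1 \bo sqY n.+1) -
    (2^-1)%:C *: (A + sqY n \bo sqY n) by [].
  move: (sqY n.+1) (sqY n) cm => Y' Y cm; apply: bop_ext => x.
  rewrite !appE -scalerBr; congr (_ *: _).
  by rewrite !bopD cm opprD addrACA subrr add0r opprD addrA addrK.
apply: NN_scale; first by rewrite invr_ge0.
by apply: NN_comp => //; apply: NN_add; exact: NN_sqY.
Qed.

Lemma NN_sqY_diff n k : NN (sqY (n + k) - sqY n) (sqy (n + k) - sqy n).
Proof.
elim: k => [|k IH]; first by rewrite addn0 !subrr; exact: NN_zero.
have := NN_add (NN_sqY_step (n + k)) IH.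
by rewrite !addrA !addrNK addnS.
Qed.

Lemma sqy_le1 n : sqy n <= 1.
Proof.
elim: n => [|n IH] /=; first exact: ler01.
by have := NN_ge0 (NN_sqY n); nra.
Qed.

Lemma sqy_mono n k : sqy n <= sqy (n + k).
Proof. by have := NN_ge0 (NN_sqY_diff n k); rewrite subr_ge0. Qed.

Lemma sqy_cauchy (e : R) : 0 < e ->
  exists N, forall n m, (N <= n)%N -> (N <= m)%N -> `|sqy n - sqy m| < e.
Proof.
move=> e0; pose E := range sqy.
have hE : has_sup E.
  by split; [exists (sqy 0), 0|exists 1 => _ [n _ <-]; exact: sqy_le1].
have [_ [N _ <-] hN] := sup_adherent e0 hE.
have ub n : sqy n <= sup E by apply: ub_le_sup; [case: hE|exists n].
exists N => n m Nn Nm; have := ub n; have := ub m.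
have := sqy_mono N (n - N); have := sqy_mono N (m - N).
by rewrite !subnKC // => h1 h2 h3 h4; rewrite ltr_norml; apply/andP; split; lra.
Qed.

Lemma sqY_dist n m x : nr (sqY n x - sqY m x) <= `|sqy n - sqy m| * nr x.
Proof.
wlog nm : n m / (n <= m)%N.
  move=> h; have /orP[/h//|/h] := leq_total n m.
  by rewrite nr_distC distrC.
rewrite nr_distC distrC -(subnKC nm).
have := NN_sqY_diff n (m - n) => d; have := NN_bound d x.
by rewrite ger0_norm //; exact: NN_ge0 d.
Qed.

Lemma sqrt_one_minus : selfadjoint A -> exists S : bop H H,
  [/\ op_nonneg S, forall x, S (S x) = x - A x &
      forall C : bop H H, (forall x, C (A x) = A (C x)) -> forall x, C (S x) = S (C x)].
Proof.
move=> Asa.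
have /choice[f fP] : forall x : H, exists y : H, (fun n => sqY n x) @ \oo --> y.
  move=> x; apply: cauchy_nr_cvg => e e0.
  have c0 : 0 < nr x + 1 by rewrite ltr_wpDl ?nr_ge0.
  have [N Nh] := sqy_cauchy (divr_gt0 e0 c0).
  exists N => n m Nn Nm; apply: le_lt_trans (sqY_dist _ _ _) _.
  have := Nh n m Nn Nm; rewrite ltr_pdivlMr //; apply: le_lt_trans.
  by rewrite ler_wpM2l // lerDl.
have fl : linear f.
  move=> a x y; apply: lim_unique (fP _) _.
  under eq_fun do rewrite bopD bopZ.
  by apply: cvgD; [apply: cvgZl_tmp|]; exact: fP.
have Yb n x : nr (sqY n x) <= nr x.
  apply: le_trans (NN_bound (NN_sqY n) x) _.
  by rewrite -[leRHS]mul1r ler_wpM2r ?nr_ge0 ?sqy_le1.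
have fb x : nr (f x) <= 1 * nr x.
  by rewrite mul1r; apply: nr_cvg_le (fP x) _ => n.
have [Y YE] := bop_of_bound fl fb.
have Ylim x : (fun n => sqY n x) @ \oo --> Y x by rewrite YE.
have YY x : (fun n => sqY n (sqY n x)) @ \oo --> Y (Y x).
  apply/cvg_nrP => e e0.
  have [N Nh] := (cvg_nrP _ _).1 (Ylim x) (e / 2) ltac:(by rewrite divr_gt0).
  have [M Mh] := (cvg_nrP _ _).1 (Ylim (Y x)) (e / 2) ltac:(by rewrite divr_gt0).
  exists (maxn N M) => n; rewrite geq_max => /andP[/Nh h1 /Mh h2].
  apply: le_lt_trans (nr_dist_tri (sqY n (Y x)) _ _) _.
  by rewrite -bopB; have := Yb n (sqY n x - Y x); lra.
have fix_ x : Y x = (2^-1)%:C *: (A x + Y (Y x)).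
  apply: (@lim_unique R H (fun n => sqY n.+1 x)).
    apply/cvg_nrP => e /((cvg_nrP _ _).1 (Ylim x))[N Nh].
    by exists N => n Nn; apply: Nh; exact: leqW.
  by apply: cvgZl_tmp; apply: cvgD; [exact: cvg_cst|exact: YY].
have Ysa : selfadjoint Y.
  move=> x y; apply: (@lim_unique R R[i]^o (fun n => '[sqY n x, y])).
    by apply: cvg_dot => //; exact: cvg_cst.
  under eq_fun => n do rewrite (NN_sa (NN_sqY n) Asa).
  by apply: cvg_dot => //; exact: cvg_cst.
exists (\id_H - Y); split.
- apply/nonnegP; split=> x; first by move=> y; rewrite !appE dotBl dotBr Ysa.
  rewrite !appE dotBl ReD ReN dotxx ReR.
  have := Re_le_nr '[Y x, x]; have := nr_dot (Y x) x.
  have := fb x; rewrite -YE mul1r => h1 h2 h3.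
  have : nr (Y x) * nr x <= nr x * nr x by rewrite ler_wpM2r ?nr_ge0.
  by rewrite -expr2; lra.
- move=> x; rewrite !appE bopB.
  have h : Y x + Y x = A x + Y (Y x).
    rewrite {1 2}fix_ -scalerDl -rmorphD /=.
    have -> : (2^-1 + 2^-1 : R) = 1 by field.
    by rewrite scale1r.
  have -> : x - Y x - (Y x - Y (Y x)) = x - (Y x + Y x) + Y (Y x).
    by rewrite opprB opprD !addrA [LHS]addrAC.
  by rewrite h opprD !addrA addrNK.
- move=> C CA x; rewrite !appE bopB; congr (_ - _).
  apply: (@lim_unique R H (fun n => C (sqY n x))); first exact: bop_cvg.
  under eq_fun => n do rewrite (NN_comm (NN_sqY n) CA).
  exact: Ylim.
Qed.

End Iteration.

(** This is T^2 <= c T. It follows by evaluating the form of T at x - T x / c and bounding (T T x, T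
    x) by c |T x|^2. In particular a vector on which the form vanishes lies in ker T. *)
Lemma nonneg_bound T c : op_nonneg T -> 0 < c ->
  (forall x, nr (T x) <= c * nr x) ->
  forall x, nr (T x) ^+ 2 <= c * complex.Re '[T x, x].
Proof.
move=> /nonnegP[Tsa T0] c0 Tc x.
have := T0 (x - (c^-1)%:C *: T x).
rewrite !bopE !dotBl !dotBr !dotZl !dotZrR (Tsa (T x) x) !dotxx.
rewrite !ReD !ReN !ReD !ReN !ReRM /= => h.
have := Re_le_nr '[T (T x), T x]; have := nr_dot (T (T x)) (T x).
have := Tc (T x); set a := nr (T x); set b := complex.Re '[T x, x] => h1 h2 h3.
have h4 : complex.Re '[T (T x), T x] <= c * a ^+ 2.
  apply: le_trans h3 (le_trans h2 _); rewrite expr2 mulrA.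
  by rewrite ler_wpM2r // nr_ge0.
have h5 : c^-1 * (c^-1 * complex.Re '[T (T x), T x]) <= c^-1 * a ^+ 2.
  rewrite ler_pM2l ?invr_gt0 // mulrC ler_pdivrMr //.
  by rewrite mulrC.
have h6 : c^-1 * a ^+ 2 <= b by move: h h5; rewrite -/a -/b; lra.
by rewrite -ler_pdivrMl.
Qed.

Lemma sqrt_exists T : op_nonneg T -> exists S : bop H H,
  [/\ op_nonneg S, forall x, S (S x) = T x &
      forall C : bop H H, (forall x, C (T x) = T (C x)) -> forall x, C (S x) = S (C x)].
Proof.
move=> T0; have [c c0 Tc] := bop_bound T.
have [Tsa Tr] := (nonnegP T).1 T0.
(* With T = c (I - A), the root is the square root of c times that of I - A. Contractivity of A is
   where [nonneg_bound] enters. *)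
pose A := \id_H - (c^-1)%:C *: T.
have Ac x : nr (A x) <= nr x.
  rewrite -(ler_pXn2r (n := 2)) ?nnegrE ?nr_ge0 // /A !appE dot_sub_sq.
  rewrite dotZrR ReRM nrZ nrR ?invr_ge0 ?(ltW c0) //.
  have := nonneg_bound T0 c0 Tc x; rewrite Tsa => h.
  have : (c^-1 * nr (T x)) ^+ 2 <= c^-1 * complex.Re '[x, T x].
    rewrite exprMn expr2 -mulrA ler_pM2l ?invr_gt0 //.
    by rewrite mulrC ler_pdivrMr // mulrC.
  have := Tr x; rewrite Tsa.
  have : 0 < c^-1 by rewrite invr_gt0.
  by nra.
have Asa : selfadjoint A.
  by move=> x y; rewrite /A !appE dotBl dotBr dotZl dotZrR Tsa.
have [S [S0 SS SC]] := sqrt_one_minus Ac Asa.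
pose d := Num.sqrt c.
have d0 : 0 <= d by exact: sqrtr_ge0.
have dd : d * d = c by rewrite -expr2 sqr_sqrtr // ltW.
exists (d%:C *: S); split.
- by move=> x; rewrite appE dotZl mulr_ge0 ?lecR.
- move=> x; rewrite !appE bopZ scalerA -rmorphM dd SS /A !appE.
  by rewrite subKr scalerA -rmorphM divff ?gt_eqF // scale1r.
- move=> C CT x; rewrite !appE bopZ SC // => z.
  by rewrite /A !appE bopB bopZ CT.
Qed.

(** For y = (S - S') x commutation gives S y + S' y = 0. The two forms are nonnegative with zero
    sum, so S y = S' y = 0, and then |y|^2 = (x, (S - S') y) = 0. *)
Lemma sqrt_unique T S S' : op_nonneg S -> op_nonneg S' ->
  (forall x, S (S x) = T x) -> (forall x, S' (S' x) = T x) ->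
  (forall x, S' (S x) = S (S' x)) -> S = S'.
Proof.
move=> /nonnegP[Ssa S0] /nonnegP[Ssa' S0'] ST ST' SS'.
apply: bop_ext => x; apply/eqP; rewrite -subr_eq0; apply/eqP.
pose D := S - S'.
have Dsa : selfadjoint D by move=> u v; rewrite /D !appE dotBl dotBr Ssa Ssa'.
pose y := D x.
have Sy : S y + S' y = 0.
  rewrite /y /D !appE !bopB ST ST' SS' addrA subrK.
  by rewrite subrr.
have h : complex.Re '[S y, y] + complex.Re '[S' y, y] = 0.
  by rewrite -ReD -dotDl Sy dot0l.
have S1 : S y = 0.
  have [c c0 Sc] := bop_bound S.
  have := nonneg_bound ((nonnegP S).2 (conj Ssa S0)) c0 Sc y.
  have -> : complex.Re '[S y, y] = 0 by have := S0 y; have := S0' y; lra.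
  rewrite mulr0 => h'; apply/eqP; rewrite -nr_eq0 -sqrf_eq0 eq_le h'.
  by rewrite exprn_ge0 // nr_ge0.
have S1' : S' y = 0 by move: Sy; rewrite S1 add0r.
suff : y = 0 by [].
by apply: dotxx_eq0; rewrite {1}/y Dsa /D !appE S1 S1' subrr dot0r.
Qed.

Lemma bop_sqrtP T : op_nonneg T ->
  [/\ op_nonneg (bop_sqrt T), forall x, bop_sqrt T (bop_sqrt T x) = T x &
      forall C : bop H H, (forall x, C (T x) = T (C x)) ->
        forall x, C (bop_sqrt T x) = bop_sqrt T (C x)].
Proof.
move=> T0; have [S [S0 ST SC]] := sqrt_exists T0.
suff -> : bop_sqrt T = S by [].
apply: xget_unique; first by split=> //; apply: bop_ext => x; rewrite appE.
move=> S' [S0' /(congr1 (@bop_fun _ _ _)) ST'].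
have ST2 x : S' (S' x) = T x by rewrite -ST'.
(* Any other root commutes with its own square T, hence with the root S just built, as uniqueness
   demands. *)
apply/esym; apply: (sqrt_unique S0 S0' ST ST2); apply: SC => x.
by rewrite -!ST2.
Qed.

End SelfAdjoint.

(** * The closed form of a relation A F^-1 A *)

Section MoorePenrose.
Variables (R : realType) (G : hilbertType R) (A : bop G G).
Hypothesis A_sa : selfadjoint A.

(* For selfadjoint [A] this is the closure of [range A]. *)
Definition coker (x : G) := forall k, A k = 0 -> '[x, k] = 0.

Lemma coker_range x : coker (A x).
Proof. by move=> k Ak; rewrite A_sa Ak dot0r. Qed.

Lemma cokerB x y : coker x -> coker y -> coker (x - y).
Proof. by move=> hx hy k Ak; rewrite dotBl hx // hy // subrr. Qed.

Lemma cokerD x y : coker x -> coker y -> coker (x + y).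
Proof. by move=> hx hy k Ak; rewrite dotDl hx // hy // addr0. Qed.

Lemma cokerZ a x : coker x -> coker (a *: x).
Proof. by move=> hx k Ak; rewrite dotZl hx // mulr0. Qed.

Lemma coker_inj x y : coker x -> coker y -> A x = A y -> x = y.
Proof.
move=> hx hy Axy; apply/eqP; rewrite -subr_eq0; apply/eqP/dotxx_eq0.
by apply: cokerB => //; rewrite bopB Axy subrr.
Qed.

Lemma coker_lim (u : nat -> G) x : (forall n, coker (u n)) -> u @ \oo --> x -> coker x.
Proof.
move=> uK ux k Ak; apply: (@lim_unique R R[i]^o (fun n => '[u n, k])).
  by apply: cvg_dot => //; exact: cvg_cst.
by under eq_fun => n do rewrite uK //; exact: cvg_cst.
Qed.

Lemma coker_closure x : coker x -> closure (range A) x.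
Proof. by move=> hx; apply: ran_ortho_ker => k; rewrite adj_sa //; exact: hx. Qed.

Lemma coker_preimage x : exists2 y, coker y & A x = A y.
Proof.
pose K := cortho [set k | A k = 0].
have KP y : cset K y <-> coker y by [].
exists (csval (cproj K x)); first exact: (cset_csval (cproj K x)).
apply/eqP; rewrite -subr_eq0 -bopB; apply/eqP/dot_ext => w.
by rewrite dot0l A_sa cprojP //; exact: coker_range.
Qed.

Lemma mp_invE x : coker x -> mp_inv A (A x) = x.
Proof.
move=> hx; apply: xget_unique.
  by split=> // w; rewrite subrr dot0l.
move=> y [hy yx]; apply: coker_inj => //.
apply/eqP; rewrite eq_sym -subr_eq0; apply/eqP/dotxx_eq0.
by rewrite -bopB in yx *; exact: yx.
Qed.

End MoorePenrose.

Section FormOfRelation.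
Variables (R : realType) (G : hilbertType R) (A F Fi : bop G G).
Variable N : set (G * G).
Hypotheses (A_sa : selfadjoint A) (F_coercive : coercive F)
  (FFi : forall x, F (Fi x) = x) (FiF : forall x, Fi (F x) = x)
  (F_coker : forall x, coker A x -> coker A (F x))
  (Fi_coker : forall x, coker A x -> coker A (Fi x)).
Hypothesis NE : forall u u', N (u, u') <->
  exists h, u = A (Fi (A h)) /\ u' = h + h - u.

Let q x y := 2 * '[F x, y] - '[A x, A y].
Let D := rel_dom N.
Let t := rel_form N.

Let domP u : D u <-> exists h, u = A (Fi (A h)).
Proof.
split=> [[u' /NE[h [-> _]]]|[h ->]]; first by exists h.
by exists (h + h - A (Fi (A h))); apply/NE; exists h.
Qed.

Let FiA_coker h : coker A (Fi (A h)).
Proof. by apply: Fi_coker; exact: coker_range. Qed.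

Let dom_coker u : D u -> exists2 x, coker A x & u = A x.
Proof. by move=> /domP[h ->]; exists (Fi (A h)). Qed.

Let domB u v : D u -> D v -> D (u - v).
Proof. by move=> /domP[h ->] /domP[k ->]; apply/domP; exists (h - k); rewrite !bopB. Qed.

(** If A x = A (Fi (A h)), injectivity of A on [coker A] gives A h = F x, so the parameter h
    disappears from (2 h - A x, A y). The value is therefore the same for every admissible u', which
    pins down the [xget] in [rel_form]. *)
Let rel_formE x y : coker A x -> coker A y -> D (A x) -> t (A x) (A y) = q x y.
Proof.
move=> hx hy Dx.
have val u' : N (A x, u') -> '[u', A y] = q x y.
  move=> /NE[h [xh ->]]; rewrite dotBl dotDl /q.
  have -> : '[h, A y] = '[F x, y].
    by rewrite -A_sa (coker_inj hx (FiA_coker h) xh) FFi.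
  by ring.
apply: xget_unique => [|c [u' /val <-]//].
by case: Dx => u' Nu; exists u' => //; rewrite val.
Qed.

Let q_bound : exists2 c : R, 0 < c & forall x, nr (q x x) <= c * nr x ^+ 2.
Proof.
have [a a0 Aa] := bop_bound A; have [b b0 Fb] := bop_bound F.
exists (2 * b + a ^+ 2); first by rewrite addr_gt0 ?mulr_gt0 ?exprn_gt0.
move=> x.
have tri : nr (q x x) <= nr (2 * '[F x, x]) + nr '[A x, A x] by exact: nr_leB.
have h1 : nr (2 * '[F x, x]) <= 2 * (b * nr x ^+ 2).
  have -> : (2 : R[i]) = 2%:C by rewrite rmorph_nat.
  rewrite nrM nrR // ler_pM2l //; apply: le_trans (nr_dot _ _) _.
  by rewrite expr2 mulrA ler_wpM2r ?nr_ge0.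
have h2 : nr '[A x, A x] <= a ^+ 2 * nr x ^+ 2.
  rewrite dotxx nrR ?exprn_ge0 ?nr_ge0 // -exprMn.
  by rewrite ler_pXn2r // nnegrE ?mulr_ge0 ?nr_ge0 // ltW.
by rewrite mulrDl -mulrA; apply: le_trans tri (lerD h1 h2).
Qed.

(** In the coordinate x the form is bounded, so norm convergence of coordinates already yields
    convergence in the sense of the form. *)
Let form_cvg_of (u : nat -> G) (x : nat -> G) l :
  (forall n, D (u n)) -> (forall n, coker A (x n)) -> (forall n, u n = A (x n)) ->
  x @ \oo --> l -> form_cvg D t u (A l).
Proof.
move=> Du xK uE xl; split=> //.
  rewrite (_ : u = fun n => A (x n)); last by apply/funext.
  exact: bop_cvg.
move=> e e0; have er : e = (complex.Re e)%:C by rewrite RRe_real // gtr0_real.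
move: e0; rewrite er ltcR; move: (complex.Re e) => {er}e e0.
have [c c0 qc] := q_bound.
pose d := Num.min 1 (e / c); have d0 : 0 < d by rewrite lt_min ltr01 divr_gt0.
have [M Mh] := (cvg_nrP _ _).1 xl (d / 2) ltac:(by rewrite divr_gt0).
exists M => n k /Mh hn /Mh hk; rewrite nrE ltcR.
have uB : u n - u k = A (x n - x k) by rewrite bopB !uE.
rewrite uB rel_formE -?uB; [|exact: cokerB|exact: cokerB|exact: domB].
apply: le_lt_trans (qc _) _; rewrite mulrC -ltr_pdivlMr //.
have h : nr (x n - x k) < d.
  by apply: le_lt_trans (nr_dist_tri l _ _) _; rewrite [nr (l - _)]nr_distC; lra.
have h1 : nr (x n - x k) ^+ 2 < d ^+ 2 by rewrite ltr_pXn2r ?nnegrE ?nr_ge0 ?ltW.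
apply: lt_le_trans h1 _; apply: le_trans (_ : d * 1 <= _).
  by rewrite expr2 ler_pM2l // ge_min lexx.
by rewrite mulr1 ge_min lexx orbT.
Qed.

(** Conversely, 2 (F w, w) = q(w, w) + |A w|^2 and coercivity of F show that form convergence makes
    the coordinates Cauchy. This confines the closure to the range of A. *)
Let form_cvg_inv (u : nat -> G) l : form_cvg D t u l ->
  exists x : nat -> G, exists y, [/\ forall n, coker A (x n), forall n, u n = A (x n),
    coker A y, l = A y & x @ \oo --> y].
Proof.
move=> [Du ul ut].
have /choice[x xP] : forall n, exists x, coker A x /\ u n = A x.
  by move=> n; have [x] := dom_coker (Du n); exists x.
have uB n k : u n - u k = A (x n - x k) by rewrite bopB -!(proj2 (xP _)).
have [c c0 Fc] := F_coercive.
have [y xy] : exists y : G, x @ \oo --> y.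
  apply: cauchy_nr_cvg => e e0.
  (* Both |q(w, w)| and |A w|^2 are made smaller than d, so that 2 c |w|^2 < 2 d. The minimum with 1
     below turns |A w| < d' into |A w|^2 < d. *)
  pose d := c * e ^+ 2; have d0 : 0 < d by rewrite mulr_gt0 ?exprn_gt0.
  pose d' := Num.min 1 d; have d'0 : 0 < d' by rewrite lt_min ltr01.
  have [N1 h1] := ut d%:C ltac:(by rewrite ltcR).
  have [N2 h2] := (cvg_nrP _ _).1 ul (d' / 2) ltac:(by rewrite divr_gt0).
  exists (maxn N1 N2) => n k; rewrite !geq_max.
  move=> /andP[n1 /h2 n2] /andP[k1 /h2 k2].
  have := h1 n k n1 k1; rewrite uB rel_formE -?uB; last 3 first.
  - by apply: cokerB; exact: (proj1 (xP _)).
  - by apply: cokerB; exact: (proj1 (xP _)).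
  - exact: domB.
  rewrite nrE ltcR; set w := x n - x k => qw.
  have Aw : nr (A w) < d'.
    rewrite -uB; apply: le_lt_trans (nr_dist_tri l _ _) _.
    by rewrite [nr (l - _)]nr_distC; lra.
  have Aw2 : nr (A w) ^+ 2 < d.
    have h : nr (A w) ^+ 2 < d' ^+ 2 by rewrite ltr_pXn2r ?nnegrE ?nr_ge0 ?ltW.
    apply: lt_le_trans h _; apply: le_trans (_ : d' * 1 <= _).
      by rewrite expr2 ler_pM2l // ge_min lexx.
    by rewrite mulr1 ge_min lexx orbT.
  have Fw : 2 * nr '[F w, w] <= nr (q w w) + nr (A w) ^+ 2.
    have e2 : (2 : R[i]) = 2%:C by rewrite rmorph_nat.
    have <- : nr (2 * '[F w, w]) = 2 * nr '[F w, w] by rewrite nrM e2 nrR.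
    have <- : nr '[A w, A w] = nr (A w) ^+ 2.
      by rewrite dotxx nrR // exprn_ge0 ?nr_ge0.
    by apply: le_trans (nr_leD _ _); rewrite /q subrK.
  have : nr w ^+ 2 < e ^+ 2.
    by rewrite -(ltr_pM2l c0) -/d; have := Fc w; lra.
  by rewrite ltr_pXn2r ?nnegrE ?nr_ge0 ?ltW.
exists x, y; split=> //.
- by move=> n; exact: (proj1 (xP _)).
- by move=> n; exact: (proj2 (xP _)).
- by apply: coker_lim xy => n; exact: (proj1 (xP _)).
- apply: lim_unique ul _; rewrite (_ : u = fun n => A (x n)).
    exact: bop_cvg.
  by apply/funext => n; exact: (proj2 (xP _)).
Qed.

(** F x is a limit of vectors A h because it stays in [coker A], which is contained in the closure
    of the range; applying Fi gives coordinates of elements of the domain that converge to x. *)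
Let dense x : coker A x -> exists u, form_cvg D t u (A x).
Proof.
move=> hx; have [v [vr vx]] := closure_seq (coker_closure A_sa (F_coker hx)).
have /choice[h hv] : forall n, exists h, A h = v n.
  by move=> n; have [h _ <-] := vr n; exists h.
exists (fun n => A (Fi (A (h n)))).
apply: (form_cvg_of (x := fun n => Fi (A (h n)))) => //.
- by move=> n; apply/domP; exists (h n).
- rewrite -[X in _ --> X](FiF x); apply: bop_cvg.
  by rewrite (_ : (fun n => A (h n)) = v) //; apply/funext.
Qed.

Lemma closed_form_domE : closed_form_dom N = range A.
Proof.
apply/seteqP; split => [_ [u /form_cvg_inv[x [y [_ _ _ -> _]]]]|_ [x _ <-]].
  by exists y.
by have [y hy ->] := coker_preimage A_sa x; exact: dense.
Qed.

Lemma closed_formE x y : coker A x -> coker A y ->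
  closed_form N (A x) (A y) = 2 * '[F x, y] - '[A x, A y].
Proof.
move=> hx hy.
have lim u v : form_cvg D t u (A x) -> form_cvg D t v (A y) ->
    (fun n => t (u n) (v n)) @ \oo --> (q x y : R[i]^o).
  move=> fu fv; have [Du _ _] := fu.
  have [x_ [x' [xK uE hx' xx' xl]]] := form_cvg_inv fu.
  have [y_ [y' [yK vE hy' yy' yl]]] := form_cvg_inv fv.
  rewrite (coker_inj hx hx' xx') (coker_inj hy hy' yy').
  rewrite (_ : (fun n => _) = fun n => q (x_ n) (y_ n)); last first.
    by apply/funext => n; rewrite uE vE rel_formE // -uE.
  rewrite /q -dotZl; under eq_fun => n do rewrite -dotZl.
  apply: (@cvgB _ R[i]^o); apply: cvg_dot => //; do ?exact: bop_cvg.
  by apply: cvgZl_tmp; exact: bop_cvg.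
apply: xget_unique => [u v|c hc]; first exact: lim.
(* Without approximating sequences every scalar would meet the specification of [form_closure];
   their existence makes the value unique. *)
have [u fu] := dense hx; have [v fv] := dense hy.
exact: (@lim_unique R R[i]^o _ _ _ (hc _ _ fu fv) (lim _ _ fu fv)).
Qed.

End FormOfRelation.

(** * The transfer function *)

Section Coercivity.
Variable R : realType.

Definition resolvent (H : hilbertType R) (C : bop H H) (z : R[i]) : bop H H :=
  bop_inv (\id_H - z *: C).

(** A numerical radius at most 1 keeps |(x, x) - z (C x, x)| above (1 - |z|) |x|^2. *)
Lemma coercive_resolvent (H : hilbertType R) (C : bop H H) (z : R[i]) :
  (forall x, nr '[C x, x] <= nr x ^+ 2) -> nr z < 1 -> coercive (\id_H - z *: C).
Proof.
move=> Cn z1; exists (1 - nr z); first by rewrite subr_gt0.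
move=> x; rewrite !appE dotBl dotZl.
have := nr_leB '[x, x] ('[x, x] - z * '[C x, x]).
rewrite subKr nrM dotxx nrR ?exprn_ge0 ?nr_ge0 // => h.
have h2 := nr_leD ('[x, x] - z * '[C x, x]) (z * '[C x, x]).
rewrite subrK nrM dotxx nrR ?exprn_ge0 ?nr_ge0 // in h2.
have : nr z * nr '[C x, x] <= nr z * nr x ^+ 2 by rewrite ler_wpM2l ?nr_ge0.
by rewrite mulrBl mul1r; lra.
Qed.

(* With [z = a + i b], this is a lower bound for
   [Re (X - z p + |z|^2 q)] when [|p - conj z q|^2 <= X (p - q)]: multiplied by
   [p - q] it reduces to the identity
   [p (p (1 - a) + q (|z|^2 - a)) =
    p / 2 ((p + q) |1 - z|^2 + (p - q) (1 - |z|^2))]. *)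
Lemma coercivity_scalar (X p q a b d : R) : 0 <= X -> `|q| <= p ->
  0 <= d -> 4 * d <= (1 - a) ^+ 2 + b ^+ 2 -> 4 * d <= 1 - (a ^+ 2 + b ^+ 2) ->
  0 < (1 - a) ^+ 2 + b ^+ 2 ->
  (p - a * q) ^+ 2 + (b * q) ^+ 2 <= X * (p - q) ->
  d * X <= X - a * p + (a ^+ 2 + b ^+ 2) * q.
Proof.
move=> X0 qp d0 d1 d2 z1 hX.
move: qp; rewrite ler_norml => /andP[q1 q2].
have d4 : 4 * d <= 1 by have := sqr_ge0 a; have := sqr_ge0 b; lra.
have [pq|pq] := eqVneq p q.
  have : p ^+ 2 * ((1 - a) ^+ 2 + b ^+ 2) <= 0.
    move: hX; rewrite -pq subrr mulr0.
    have -> // : p ^+ 2 * ((1 - a) ^+ 2 + b ^+ 2) = (p - a * p) ^+ 2 + (b * p) ^+ 2.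
    by ring.
  rewrite pmulr_lle0 // => p2.
  have p0 : p = 0 by apply/eqP; rewrite -sqrf_eq0 eq_le p2 sqr_ge0.
  by move: pq; rewrite p0 => <-; nra.
have pq0 : 0 < p - q by rewrite subr_gt0 lt_neqAle eq_sym pq.
have p0 : 0 <= p by lra.
rewrite -subr_ge0 -(pmulr_rge0 _ pq0).
set Y := (p - a * q) ^+ 2 + (b * q) ^+ 2 in hX.
(* Here Y = |p - conj z q|^2 <= (p + |q|)^2. This is the origin of the factor 4 in the hypotheses on
   d: the loss d Y is absorbed by 4 d p^2. *)
have Y4 : Y <= 4 * p ^+ 2.
  have a1 : a ^+ 2 + b ^+ 2 <= 1 by lra.
  have q3 : q ^+ 2 <= p ^+ 2 by nra.
  have b2 : (b * q) ^+ 2 <= b ^+ 2 * p ^+ 2.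
    by rewrite exprMn ler_wpM2l ?sqr_ge0.
  have a2 : (p - a * q) ^+ 2 <= 2 * p ^+ 2 + 2 * (a ^+ 2 * p ^+ 2).
    have : a ^+ 2 * q ^+ 2 <= a ^+ 2 * p ^+ 2 by rewrite ler_wpM2l ?sqr_ge0.
    have : 0 <= (p + a * q) ^+ 2 by exact: sqr_ge0.
    by nra.
  have b3 : b ^+ 2 * p ^+ 2 + a ^+ 2 * p ^+ 2 <= p ^+ 2.
    by rewrite -mulrDl addrC -[leRHS]mul1r ler_wpM2r ?sqr_ge0.
  have b4 : 0 <= b ^+ 2 * p ^+ 2 by rewrite mulr_ge0 ?sqr_ge0.
  by rewrite /Y; lra.
have main : 4 * d * p ^+ 2 <= p * (p * (1 - a) + q * (a ^+ 2 + b ^+ 2 - a)).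
  have -> : p * (p * (1 - a) + q * (a ^+ 2 + b ^+ 2 - a)) =
    p * (((p + q) * ((1 - a) ^+ 2 + b ^+ 2) + (p - q) * (1 - (a ^+ 2 + b ^+ 2))) / 2).
    by field.
  rewrite expr2 mulrCA ler_wpM2l //.
  have h1 : (p + q) * (4 * d) <= (p + q) * ((1 - a) ^+ 2 + b ^+ 2).
    by rewrite ler_wpM2l //; lra.
  have h2 : (p - q) * (4 * d) <= (p - q) * (1 - (a ^+ 2 + b ^+ 2)).
    by rewrite ler_wpM2l //; lra.
  by lra.
have -> : (p - q) * (X - a * p + (a ^+ 2 + b ^+ 2) * q - d * X) =
  (1 - d) * (X * (p - q) - Y) - d * Y +
  p * (p * (1 - a) + q * (a ^+ 2 + b ^+ 2 - a)).
  by rewrite /Y; ring.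
have h3 : 0 <= (1 - d) * (X * (p - q) - Y) by rewrite mulr_ge0 // ?subr_ge0 //; lra.
have h4 : d * Y <= d * (4 * p ^+ 2) by rewrite ler_wpM2l.
by lra.
Qed.

End Coercivity.

Section TransferFunction.
Variables (R : realType) (H G : hilbertType R).
Variables (Ap Am : bop G G) (M : bop G H) (C0 C : bop H H) (z : R[i]).
Hypotheses (Ap_sa : selfadjoint Ap) (Am_sa : selfadjoint Am).
Hypothesis ApAm : forall x, Ap (Am x) = Am (Ap x).
Hypothesis sum_sq : forall x, Ap (Ap x) + Am (Am x) = x + x.
Hypothesis M_coker : forall h, coker Ap (adj M h).
Hypothesis C0_sa : selfadjoint C0.
Hypothesis C0_num : forall x, nr '[C0 x, x] <= nr x ^+ 2.
Hypothesis C_num : forall x, nr '[C x, x] <= nr x ^+ 2.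
Hypothesis CE : forall x, C x = C0 x + M (Am (Am (adj M x))).
Hypothesis z1 : nr z < 1.

(** This is F(z) of the overview, with E = M A- written out and C0 in the role of Bhat0. *)
Definition pencil : bop G G := \id_G - z *: (Am \bo adj M \bo resolvent C0 z \bo M \bo Am).
Definition pencil_inv : bop G G := \id_G + z *: (Am \bo adj M \bo resolvent C z \bo M \bo Am).

Let res0P := bop_invP (coercive_resolvent C0_num z1).
Let resP := bop_invP (coercive_resolvent C_num z1).

(** For w = (I - z C0)^(-1) E x one has E F(z) x = (I - z C0) w - z E E^* w = (I - z C) w. Both
    resolvents thus produce the same w, and the two correction terms cancel. *)
Lemma pencilK x : pencil_inv (pencil x) = x.
Proof.
rewrite /pencil /pencil_inv !appE; set w := resolvent C0 z _.
have wE : w - z *: C0 w = M (Am x) by have := res0P.2 (M (Am x)); rewrite !appE.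
have -> : resolvent C z (M (Am (x - z *: Am (adj M w)))) = w.
  rewrite -[RHS]resP.1 /resolvent; congr (bop_inv _ _).
  by rewrite !bopB !bopZ -wE !appE CE scalerDr opprD addrA.
by rewrite subrK.
Qed.

Lemma pencil_invK x : pencil (pencil_inv x) = x.
Proof.
rewrite /pencil /pencil_inv !appE; set w := resolvent C z _.
have wE : w - z *: C w = M (Am x) by have := resP.2 (M (Am x)); rewrite !appE.
have -> : resolvent C0 z (M (Am (x + z *: Am (adj M w)))) = w.
  rewrite -[RHS]res0P.1 /resolvent; congr (bop_inv _ _).
  by rewrite !bopD !bopZ -wE !appE CE scalerDr opprD addrA subrK.
by rewrite addrK.
Qed.

Let Am_coker x : coker Ap x -> coker Ap (Am x).
Proof. by move=> hx k k0; rewrite Am_sa hx // ApAm k0 bop0. Qed.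

Lemma pencil_coker x : coker Ap x -> coker Ap (pencil x).
Proof.
move=> hx; rewrite /pencil !appE; apply: cokerB => //.
by apply: cokerZ; apply: Am_coker; exact: M_coker.
Qed.

Lemma pencil_inv_coker x : coker Ap x -> coker Ap (pencil_inv x).
Proof.
move=> hx; rewrite /pencil_inv !appE; apply: cokerD => //.
by apply: cokerZ; apply: Am_coker; exact: M_coker.
Qed.

(** Put w = (I - z C0)^(-1) E x, p = |w|^2 and q = (C0 w, w), which is real. Then (E^* w, x) = p -
    conj z q and (F x, x) = |x|^2 - z (p - conj z q). From (C w, w) <= |w|^2 follows |E^* w|^2 <= p
    - q, and Cauchy-Schwarz gives the hypothesis of [coercivity_scalar] with X = |x|^2. *)
Lemma pencil_coercive : coercive pencil.
Proof.
pose a := complex.Re z; pose b := complex.Im z.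
have zn : nr z ^+ 2 = a ^+ 2 + b ^+ 2 by rewrite nr_sq.
have zlt : a ^+ 2 + b ^+ 2 < 1.
  by rewrite -zn expr_lt1 // nr_ge0.
have z10 : 0 < (1 - a) ^+ 2 + b ^+ 2.
  have := Re_le_nr z; rewrite -/a => az.
  have : 0 < (1 - a) ^+ 2 by rewrite exprn_gt0 // subr_gt0 (le_lt_trans az).
  by have := sqr_ge0 b; lra.
pose d := Num.min ((1 - a) ^+ 2 + b ^+ 2) (1 - (a ^+ 2 + b ^+ 2)) / 4.
have d4 : 4 * d = Num.min ((1 - a) ^+ 2 + b ^+ 2) (1 - (a ^+ 2 + b ^+ 2)).
  by rewrite /d; field.
have d0 : 0 < d by rewrite divr_gt0 // lt_min z10 subr_gt0.
exists d => // x.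
pose w := resolvent C0 z (M (Am x)).
have wE : M (Am x) = w - z *: C0 w by have := res0P.2 (M (Am x)); rewrite !appE.
pose p := nr w ^+ 2; pose q := complex.Re '[C0 w, w].
have C0w : '[C0 w, w] = q%:C by exact: sa_dotE.
have Fx : '[pencil x, x] = (nr x ^+ 2)%:C - z * (p%:C - Num.conj z * q%:C).
  rewrite /pencil !appE dotBl dotZl -/w dotxx Am_sa -adjPr.
  by rewrite wE dotBr dotZr -C0_sa C0w dotxx.
have wM : '[adj M w, Am x] = p%:C - Num.conj z * q%:C.
  by rewrite -adjPr wE dotBr dotZr -C0_sa C0w dotxx.
have ReF : complex.Re '[pencil x, x] = nr x ^+ 2 - a * p + (a ^+ 2 + b ^+ 2) * q.
  rewrite Fx /a /b; case: (z) => u v; rewrite /= ; ring.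
have qp : `|q| <= p.
  by have := C0_num w; rewrite C0w nrCR.
have bound : (p - a * q) ^+ 2 + (b * q) ^+ 2 <= nr x ^+ 2 * (p - q).
  have -> : (p - a * q) ^+ 2 + (b * q) ^+ 2 = nr '[Am (adj M w), x] ^+ 2.
    rewrite Am_sa wM nr_sq /a /b; case: (z) => u v; rewrite /=; ring.
  have h : nr (Am (adj M w)) ^+ 2 <= p - q.
    have : complex.Re '[C w, w] <= p by apply: le_trans (Re_le_nr _) (C_num w).
    rewrite CE dotDl C0w ReD ReR.
    have -> : '[M (Am (Am (adj M w))), w] = '[Am (adj M w), Am (adj M w)].
      by rewrite adjP Am_sa.
    by rewrite dotxx ReR; lra.
  apply: le_trans (_ : (nr (Am (adj M w)) * nr x) ^+ 2 <= _).
    by rewrite ler_pXn2r ?nnegrE ?mulr_ge0 ?nr_ge0 // nr_dot.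
  by rewrite exprMn mulrC ler_wpM2l // exprn_ge0 // nr_ge0.
apply: le_trans (Re_le_nr _); rewrite ReF.
apply: coercivity_scalar => //; rewrite ?exprn_ge0 ?nr_ge0 ?(ltW d0) //.
- by rewrite d4 ge_min lexx.
- by rewrite d4 ge_min lexx orbT.
Qed.

(** Replacing A+^2 by 2 I - A-^2 cancels 2 (x, y), after which A- can be extracted from every
    remaining term. *)
Lemma pencil_form x y : 2 * '[pencil x, y] - '[Ap x, Ap y] =
  '[Am x - (2 * z) *: adj M (resolvent C0 z (M (Am x))), Am y].
Proof.
rewrite /pencil !appE -[X in _ - X]Ap_sa.
have -> : Ap (Ap x) = x + x - Am (Am x) by rewrite -sum_sq addrK.
rewrite !dotBl dotDl !dotZl !Am_sa; ring.
Qed.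

Lemma transfer_relation_form (N : set (G * G)) :
  (forall u u', N (u, u') <-> exists h, u = Ap (pencil_inv (Ap h)) /\ u' = h + h - u) ->
  closed_form_dom N = range Ap /\
  forall x y, coker Ap x -> coker Ap y -> closed_form N (Ap x) (Ap y) =
    '[Am x - (2 * z) *: adj M (resolvent C0 z (M (Am x))), Am y].
Proof.
move=> NE; split.
  exact: (closed_form_domE Ap_sa pencil_coercive pencil_invK pencilK
    pencil_coker pencil_inv_coker NE).
move=> x y hx hy; rewrite -pencil_form.
exact: (closed_formE Ap_sa pencil_coercive pencil_invK pencilK
  pencil_coker pencil_inv_coker NE).
Qed.

End TransferFunction.

(** * Polar decomposition and shorted operators *)

Section Polar.
Variables (R : realType) (H G : hilbertType R) (Delta : bop H H) (T : bop H G).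
Hypothesis DeltaE : forall x, Delta x = adj T (T x).

Lemma polar_nonneg : op_nonneg Delta.
Proof. by move=> x; rewrite DeltaE -adjPr hdotxx exprn_ge0. Qed.

(** With S the root of [Delta], |T x| = |S x|. Since the domain is the closure of the range of
    [Delta] and not of S, V is defined by S (S x) -> T (S x). *)
Lemma polar_isometry : exists2 V : bop (csub (ran_closure Delta)) G, isometric V &
  forall x, V (cproj (ran_closure Delta) (bop_sqrt Delta x)) = T x.
Proof.
have [S0 SS _] := bop_sqrtP polar_nonneg; set S := bop_sqrt Delta in S0 SS *.
have Ssa := nonneg_selfadjoint S0.
have TS x : nr (T x) = nr (S x).
  apply/eqP; rewrite -(eqrXn2 (n := 2)) ?nr_ge0 //.
  rewrite -(ReR (nr (T x) ^+ 2)) -(ReR (nr (S x) ^+ 2)) -!dotxx.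
  by rewrite adjP -DeltaE -SS Ssa.
have [|V VE] := @extension R H H G Delta (T \bo S) 1.
  by move=> x; rewrite mul1r appE TS SS.
exists V.
  move=> y; rewrite !nrE; congr _%:C; apply/eqP.
  rewrite -(eqrXn2 (n := 2)) ?nr_ge0 // -(inj_eq (@complexI R)) -!dotxx; apply/eqP.
  have [u [ur uy]] := closure_seq (cset_csval y).
  have /choice[x xu] : forall n, exists x, Delta x = u n.
    by move=> n; have [x _ <-] := ur n; exists x.
  pose w n := cproj (ran_closure Delta) (u n).
  have wE n : csval (w n) = u n by rewrite /w -xu cproj_ran.
  have wy : w @ \oo --> y.
    apply/cvg_nrP => e /((cvg_nrP _ _).1 uy)[N Nh]; exists N => n /Nh.
    by rewrite csval_nr csvalB wE.
  apply: (@lim_unique R R[i]^o (fun n => '[w n, w n])); last exact: cvg_dot.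
  have Vw : (fun n => V (w n)) @ \oo --> V y by exact: bop_cvg.
  rewrite (_ : (fun n => _) = fun n => '[V (w n), V (w n)]); first exact: cvg_dot.
  apply/funext => n; rewrite !dotxx (VE (x n)) ?wE // appE TS SS csval_nr wE.
  by rewrite xu.
(* The relation V S = T is known so far on the range of S only. It also holds on ker S, and these
   two subspaces together are dense: E vanishes on the range of S, so the values of E^* lie in ker
   S, where E vanishes again, and E E^* = 0. *)
pose E := V \bo cproj (ran_closure Delta) \bo S - T.
have ES x : E (S x) = 0.
  by rewrite /E !appE SS (VE x) ?cproj_ran // appE subrr.
have EK x : S x = 0 -> E x = 0.
  move=> Sx; rewrite /E !appE Sx !bop0 sub0r; apply/eqP.
  by rewrite oppr_eq0 -nr_eq0 TS Sx nr0.
have E0 u : adj E u = 0.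
  apply: dotxx_eq0; rewrite -adjP EK ?dot0l //.
  by apply: dot_ext => v; rewrite dot0l Ssa -adjPr ES dot0r.
move=> x; apply/eqP; rewrite -subr_eq0; apply/eqP/dot_ext_r => u.
by have := adjPr E x u; rewrite E0 dot0l dot0r.
Qed.

End Polar.

Lemma op_le_anti (R : realType) (H : hilbertType R) (S T : bop H H) :
  op_le S T -> op_le T S -> S = T.
Proof.
move=> ST TS; apply/esym/bop_ext => x; apply/eqP; rewrite -subr_eq0 -bop_subE.
have [c c0 Tc] := bop_bound (T - S).
have := nonneg_bound ST c0 Tc x.
have : complex.Re '[(T - S) x, x] <= 0.
  have := (nonnegP _).1 TS => -[_ /(_ x)].
  by rewrite !appE !dotBl !ReD !ReN; lra.
rewrite -nr_eq0 -sqrf_eq0 eq_le sqr_ge0 andbT => h1; move/le_trans; apply.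
by rewrite pmulr_rle0.
Qed.

(** * Shorted operators as Schur complements *)

Section Shorted.
Variables (R : realType) (D G : hilbertType R) (W : bop (hsum D G) (hsum D G)).
Hypothesis W0 : op_nonneg W.

Definition blk11 (X : bop (hsum D G) (hsum D G)) := hfst D G \bo X \bo hinl D G.
Definition blk12 (X : bop (hsum D G) (hsum D G)) := hfst D G \bo X \bo hinr D G.
Definition blk21 (X : bop (hsum D G) (hsum D G)) := hsnd D G \bo X \bo hinl D G.
Definition blk22 (X : bop (hsum D G) (hsum D G)) := hsnd D G \bo X \bo hinr D G.

Lemma hsum_dotE (x y : hsum D G) : '[x, y] = '[x.1, y.1] + '[x.2, y.2].
Proof. by []. Qed.

Lemma hsum_split (x : hsum D G) : x = hinl D G x.1 + hinr D G x.2.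
Proof. by case: x => d g; congr pair; rewrite /= ?addr0 ?add0r. Qed.

Lemma blk_dot (X : bop (hsum D G) (hsum D G)) (x y : hsum D G) : '[X x, y] =
  '[blk11 X x.1 + blk12 X x.2, y.1] + '[blk21 X x.1 + blk22 X x.2, y.2].
Proof. by rewrite {1}(hsum_split x) bopD hsum_dotE. Qed.

Lemma blk12_adj X : selfadjoint X -> blk12 X = adj (blk21 X).
Proof.
move=> Xsa; apply/esym/adjE => d g.
have := Xsa (hinl D G d) (hinr D G g); rewrite !hsum_dotE /= dot0l dot0r.
by rewrite addr0 add0r.
Qed.

Lemma blk22_nonneg X : op_nonneg X -> op_nonneg (blk22 X).
Proof. by move=> X0 g; have := X0 (hinr D G g); rewrite hsum_dotE /= dot0r add0r. Qed.

Let A := bop_sqrt (blk22 W).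
Let Wsa := nonneg_selfadjoint W0.
Let W22 := blk22_nonneg W0.

Let A_sa : selfadjoint A.
Proof. by have [/nonneg_selfadjoint] := bop_sqrtP W22. Qed.

Let AA g : A (A g) = blk22 W g.
Proof. by have [_ ->] := bop_sqrtP W22. Qed.

(** Testing W^2 <= c W on (0, g) gives |W12 g|^2 <= c |A g|^2, so W12 = K A with K bounded on the
    closed range of A. Taking adjoints after the projection P onto that range yields F, and P
    annihilates ker A, which places the values of F in [coker A]. *)
Lemma douglas : exists2 F : bop D G, (forall d, coker A (F d)) &
  forall d, blk21 W d = A (F d).
Proof.
have [c c0 Wc] := bop_bound W.
have bnd g : nr (blk12 W g) <= Num.sqrt c * nr (A g).
  rewrite -(ler_pXn2r (n := 2)) ?nnegrE ?mulr_ge0 ?nr_ge0 ?sqrtr_ge0 //.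
  rewrite exprMn sqr_sqrtr ?(ltW c0) // -(ReR (nr (A g) ^+ 2)) -dotxx -A_sa AA.
  have := nonneg_bound W0 c0 Wc (hinr D G g); rewrite hsum_dotE /= dot0r add0r.
  apply: le_trans; rewrite ler_pXn2r ?nnegrE ?nr_ge0 //.
  by rewrite -lecR -!nrE; exact: hsum_norm1_le.
have [K KE] := extension bnd; pose P := cproj (ran_closure A).
exists (adj (K \bo P)) => d.
  move=> k Ak; rewrite -adjPr appE (_ : P k = 0) ?bop0 ?dot0r //.
  apply: cprojE => v Kv; rewrite subr0 hdotC.
  suff -> : '[v, k] = 0 by rewrite rmorph0.
  apply: closed_hdot_eq0; apply: closureS Kv => _ [x _ <-] /=.
  by rewrite A_sa Ak dot0r.
apply: dot_ext => g; rewrite A_sa -adjPr appE (KE g) ?cproj_ran //.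
by rewrite adjP blk12_adj.
Qed.

Variable F : bop D G.
Hypotheses (F_coker : forall d, coker A (F d)) (FE : forall d, blk21 W d = A (F d)).

(** The product F^* F stands for W12 W22^(-1) W21, which makes no sense when W22 is not
    invertible. *)
Definition schur : bop D D := blk11 W - adj F \bo F.

Let Z : bop (hsum D G) (hsum D G) := hinl D G \bo schur \bo hfst D G.

Let Z_dot x : '[Z x, x] = '[schur x.1, x.1].
Proof. by rewrite hsum_dotE /= dot0l addr0. Qed.

Let complete_square x : '[W x, x] = '[Z x, x] + '[F x.1 + A x.2, F x.1 + A x.2].
Proof.
rewrite blk_dot Z_dot blk12_adj // FE -AA /schur !appE !dotE -!adjPr FE !A_sa.
by ring.
Qed.

(** Since F d lies in the closure of the range of A, the square |F d + A g|^2 has infimum 0 over g: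
    the Schur form is the minimum of the form of W over the second coordinate. *)
Let approx d (c : R) :
  (forall g, c <= complex.Re '[schur d, d] + nr (F d + A g) ^+ 2) ->
  c <= complex.Re '[schur d, d].
Proof.
move=> h; rewrite -subr_le0; apply: le_eps => e e0.
pose e' := Num.min 1 e; have e'0 : 0 < e' by rewrite lt_min ltr01.
have [_ [g _ <-] hg] := (closure_nrP _ _).1 (coker_closure A_sa (@F_coker d)) _ e'0.
have := h (- g); rewrite bopN; set a := nr _ in hg *.
have a0 : 0 <= a by exact: nr_ge0.
have : a < 1 /\ a < e.
  by split; apply: lt_le_trans hg _; rewrite ge_min lexx ?orbT.
by move=> [? ?]; nra.
Qed.

Lemma schur_nonneg : op_nonneg schur.
Proof.
apply/nonnegP; split.
  move=> x y; rewrite /schur !appE dotBl dotBr -adjPr -adjP.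
  congr (_ - _).
  have := Wsa (hinl D G x) (hinl D G y); rewrite !hsum_dotE /= dot0l dot0r.
  by rewrite !addr0.
move=> d; apply: approx => g.
have := (nonnegP _).1 W0 => -[_ /(_ (hinl D G d + hinr D G g))].
by rewrite complete_square Z_dot ReD dotxx ReR /= addr0 add0r.
Qed.

Lemma shortedE : shorted W [set x : hsum D G | x.2 = 0] = Z.
Proof.
have Z0 : op_nonneg Z by move=> x; rewrite Z_dot; exact: schur_nonneg.
have ZW : op_le Z W.
  by move=> x; rewrite appE dotBl complete_square addrC addKr hdotxx exprn_ge0.
(* A selfadjoint Z' with range in the first summand vanishes on the second, so its form ignores the
   second coordinate; Z' <= W can then be minimized over that coordinate. *)
have max Z' : op_nonneg Z' -> op_le Z' W -> range Z' `<=` [set x | x.2 = 0] -> op_le Z' Z.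
  move=> Z'0 Z'W Z'r; have Z'sa := nonneg_selfadjoint Z'0.
  have Z'2 g : Z' (hinr D G g) = 0.
    apply: dot_ext => x; rewrite dot0l Z'sa hsum_dotE /= dot0l add0r.
    by rewrite (Z'r (Z' x)) ?dot0r //; exists x.
  have Z'1 d g : '[Z' (hinl D G d + hinr D G g), hinl D G d + hinr D G g] =
                 '[Z' (hinl D G d), hinl D G d].
    by rewrite bopD Z'2 addr0 dotDr [X in _ + X]Z'sa Z'2 dot0r addr0.
  have sa : selfadjoint (Z - Z').
    by move=> x y; rewrite !appE dotBl dotBr Z'sa (nonneg_selfadjoint Z0).
  apply/nonnegP; split=> // x; rewrite appE dotBl ReD ReN subr_ge0 Z_dot.
  apply: approx => g; rewrite {1 2}(hsum_split x) Z'1 -(Z'1 x.1 g).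
  have := (nonnegP _).1 Z'W => -[_ /(_ (hinl D G x.1 + hinr D G g))].
  rewrite appE dotBl ReD ReN subr_ge0 => /le_trans; apply.
  by rewrite complete_square Z_dot ReD dotxx ReR /= addr0 add0r.
have Zr : range Z `<=` [set x | x.2 = 0] by move=> _ [x _ <-].
apply: xget_unique.
  by split; [split|move=> Z' [? ? ?]; exact: max].
move=> Z' [[Z'0 Z'W Z'r] Z'max].
have h1 := max _ Z'0 Z'W Z'r; have h2 : op_le Z Z' by apply: Z'max.
exact: op_le_anti.
Qed.

End Shorted.

(** * The shorted operators of I + X and I - X for a selfadjoint contraction X *)

Section ShortedPair.
Variables (R : realType) (D G : hilbertType R) (X : bop (hsum D G) (hsum D G)).
Hypotheses (X_sa : selfadjoint X) (X_contr : contractive X).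

Lemma nr_num (U : hilbertType R) (T : bop U U) :
  contractive T -> forall x, nr '[T x, x] <= nr x ^+ 2.
Proof.
move=> /contractive_nrP Tc x; apply: le_trans (nr_dot _ _) _.
by rewrite expr2 ler_wpM2r ?nr_ge0.
Qed.

Lemma id_add_nonneg (U : hilbertType R) (T : bop U U) :
  selfadjoint T -> contractive T -> op_nonneg (\id_U + T).
Proof.
move=> Tsa Tc; apply/nonnegP; split.
  by move=> x y; rewrite !appE dotDl dotDr Tsa.
move=> x; rewrite !appE dotDl ReD dotxx ReR.
have := nr_num Tc x; have := Re_le_nr (- '[T x, x]); rewrite ReN nrN.
by lra.
Qed.

Lemma id_sub_nonneg (U : hilbertType R) (T : bop U U) :
  selfadjoint T -> contractive T -> op_nonneg (\id_U - T).
Proof.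
move=> Tsa Tc; apply: id_add_nonneg => [x y|x].
  by rewrite !appE dotNl dotNr Tsa.
by rewrite appE normrN.
Qed.

Let S := blk22 X.
Let Ap := bop_sqrt (\id_G + S).
Let Am := bop_sqrt (\id_G - S).

Let Wp : op_nonneg (\id_(hsum D G) + X). Proof. exact: id_add_nonneg. Qed.
Let Wm : op_nonneg (\id_(hsum D G) - X). Proof. exact: id_sub_nonneg. Qed.

Let blk22p : blk22 (\id_(hsum D G) + X) = \id_G + S.
Proof. exact: bop_ext. Qed.
Let blk22m : blk22 (\id_(hsum D G) - X) = \id_G - S.
Proof. exact: bop_ext. Qed.

Let Sp : op_nonneg (\id_G + S). Proof. by rewrite -blk22p; exact: blk22_nonneg. Qed.
Let Sm : op_nonneg (\id_G - S). Proof. by rewrite -blk22m; exact: blk22_nonneg. Qed.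

Lemma sqrt_add_sa : selfadjoint Ap.
Proof. by have [/nonneg_selfadjoint] := bop_sqrtP Sp. Qed.

Lemma sqrt_sub_sa : selfadjoint Am.
Proof. by have [/nonneg_selfadjoint] := bop_sqrtP Sm. Qed.

Lemma sqrt_addE x : Ap (Ap x) = x + S x.
Proof. by have [_ ->] := bop_sqrtP Sp. Qed.

Lemma sqrt_subE x : Am (Am x) = x - S x.
Proof. by have [_ ->] := bop_sqrtP Sm. Qed.

Lemma sqrt_sum_sq x : Ap (Ap x) + Am (Am x) = x + x.
Proof. by rewrite sqrt_addE sqrt_subE addrACA subrr addr0. Qed.

Lemma sqrt_comm x : Ap (Am x) = Am (Ap x).
Proof.
have [_ _ Cm] := bop_sqrtP Sm; apply: Cm => y.
have subE u : (\id_G - S) u = u - S u by [].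
rewrite !subE bopB; congr (_ - _).
by apply: (addrI (Ap y)); rewrite -sqrt_addE -bopD -sqrt_addE.
Qed.

(* [Q] factors the off-diagonal entry as [(I+S)^{1/2} (I-S)^{1/2} Q], and the
   Schur complements of [I + X] and [I - X] become [Q^* (I-S) Q] and
   [Q^* (I+S) Q], whose sum is [2 Q^* Q]. *)
Lemma shorted_pair : let Dset := [set x : hsum D G | x.2 = 0] in
  let Z0 := hfst D G \bo
    (shorted (\id_(hsum D G) + X) Dset - \id_(hsum D G)) \bo hinl D G in
  let Z1 := hfst D G \bo
    (\id_(hsum D G) - shorted (\id_(hsum D G) - X) Dset) \bo hinl D G in
  exists Q : bop D G,
  [/\ forall d, coker Ap (Q d),
      forall d, blk21 X d = Ap (Am (Q d)),
      forall d, Z0 d = blk11 X d - adj Q (Am (Am (Q d))),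
      forall d, Z1 d = blk11 X d + adj Q (Ap (Ap (Q d))) &
      selfadjoint Z0 /\ forall d, nr '[Z0 d, d] <= nr d ^+ 2].
Proof.
move=> Dset Z0 Z1.
have [Fp cp Fp21] := douglas Wp; have [Fm cm Fm21] := douglas Wm.
have Z0E d : Z0 d = schur (\id_(hsum D G) + X) Fp d - d.
  by rewrite /Z0 !appE /Dset (shortedE Wp cp Fp21).
have Z1E d : Z1 d = d - schur (\id_(hsum D G) - X) Fm d.
  by rewrite /Z1 !appE /Dset (shortedE Wm cm Fm21).
have cp' := cp; have Fp21p := Fp21.
rewrite blk22p -/Ap in cp Fp21; rewrite blk22m -/Am in cm Fm21.
have Fp21' d : blk21 X d = Ap (Fp d) by rewrite -Fp21 /blk21 /= add0r.
have Fm21' d : blk21 X d = Am (- Fm d).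
  by rewrite bopN -Fm21 /blk21 /= sub0r opprK.
have AmC x : coker Ap x -> coker Ap (Am x).
  by move=> hx k k0; rewrite sqrt_sub_sa hx // sqrt_comm k0 bop0.
have ApC x : coker Am x -> coker Am (Ap x).
  by move=> hx k k0; rewrite sqrt_add_sa hx // -sqrt_comm k0 bop0.
(* From X21 = A+ Fp = - A- Fm one gets A+ A- Q = (A-^2 + A+^2) X21 / 2 = X21. The symmetric choice
   places Q in both [coker Ap] and [coker Am], which the two cancellations below require. *)
pose Q := (2^-1)%:C *: (Am \bo Fp - Ap \bo Fm).
have half (x : G) : (2^-1)%:C *: (x + x) = x.
  rewrite scalerDr -scalerDl -rmorphD /= (_ : 2^-1 + 2^-1 = 1 :> R) ?scale1r //.
  by field.
have Q21 d : Ap (Am (Q d)) = blk21 X d.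
  rewrite /Q !appE !bopZ !bopB -[RHS]half; congr (_ *: _).
  have -> : Ap (Am (Am (Fp d))) = Am (Am (blk21 X d)).
    by rewrite Fp21' !sqrt_comm.
  have -> : Ap (Am (Ap (Fm d))) = - Ap (Ap (blk21 X d)).
    by rewrite Fm21' bopN !bopN opprK !sqrt_comm.
  by rewrite opprK addrC sqrt_sum_sq.
have Qp d : coker Ap (Q d).
  rewrite /Q !appE; apply/cokerZ/cokerB; first exact/AmC/cp.
  by apply: coker_range; exact: sqrt_add_sa.
have Qm d : coker Am (Q d).
  rewrite /Q !appE; apply/cokerZ/cokerB; last exact/ApC/cm.
  by apply: coker_range; exact: sqrt_sub_sa.
have AmQ d : Am (Q d) = Fp d.
  by apply: (@coker_inj _ _ Ap); [exact/AmC/Qp|exact: cp|rewrite Q21 -Fp21'].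
have ApQ d : Ap (Q d) = - Fm d.
  apply: (@coker_inj _ _ Am); [exact/ApC/Qm| |by rewrite -sqrt_comm Q21 Fm21'].
  by move=> k k0; rewrite dotNl cm // oppr0.
have adjFp d : adj Fp d = adj Q (Am d).
  by apply: dot_ext_r => x; rewrite -!adjP -AmQ sqrt_sub_sa.
have adjFm d : adj Fm d = - adj Q (Ap d).
  apply: dot_ext_r => x; rewrite dotNr -!adjP -[Fm x]opprK -ApQ dotNl.
  by rewrite sqrt_add_sa.
have Z0F d : Z0 d = blk11 X d - adj Q (Am (Am (Q d))).
  rewrite Z0E /schur !appE adjFp AmQ /= [d + _]addrC.
  by rewrite addrAC addrK.
exists Q; split=> //.
- move=> d; rewrite Z1E /schur !appE.
  have -> : adj Fm (Fm d) = adj Q (Ap (Ap (Q d))).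
    by rewrite adjFm -[Fm d]opprK -ApQ !bopN opprK.
  by rewrite /= opprD opprB opprK addrA addrCA subrr addr0.
have Z0sa : selfadjoint Z0.
  move=> x y; rewrite !Z0F dotBl dotBr -!adjPr -!adjP !sqrt_sub_sa; congr (_ - _).
  have := X_sa (hinl D G x) (hinl D G y); rewrite !hsum_dotE /= dot0l dot0r.
  by rewrite !addr0.
(* The lower bound is nonnegativity of the Schur complement I + Z0; the upper bound is Z0 <= X11
   together with the contractivity of X. *)
split=> // d; rewrite sa_dotE // nrCR ler_norml; apply/andP; split.
  have := (nonnegP _).1 (schur_nonneg Wp cp' Fp21p) => -[_ /(_ d)].
  by rewrite Z0E dotBl ReD ReN dotxx ReR; lra.
rewrite Z0F dotBl ReD ReN -adjPr sqrt_sub_sa dotxx ReR.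
have := nr_num X_contr (hinl D G d); rewrite hsum_dotE /= dot0r addr0.
have -> : nr (hinl D G d) ^+ 2 = nr d ^+ 2.
  by apply: (@complexI R); rewrite -!dotxx hsum_dotE /= dot0r addr0.
have := Re_le_nr '[blk11 X d, d]; rewrite /blk11 /=.
by have := sqr_ge0 (nr (Am (Q d))); lra.
Qed.

End ShortedPair.

(** * The block operators extending [B] *)

Section BlockOperator.
Variables (R : realType) (H : hilbertType R) (H0 : csubspace H).
Variable B : bop (csub H0) H.
Hypothesis hB : hermitian_contraction B.

Lemma cproj_adjl (U : hilbertType R) (K : csubspace U) (k : csub K) (x : U) :
  '[cincl K k, x] = '[k, cproj K x].
Proof. by rewrite hdotC -cproj_adj -hdotC. Qed.

Lemma nr_cproj (U : hilbertType R) (K : csubspace U) (x : U) : nr (cproj K x) <= nr x.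
Proof.
have [->|P0] := eqVneq (cproj K x) 0; first by rewrite nr0 nr_ge0.
rewrite -(ler_pM2r (x := nr (cproj K x))) ?nr_gt0 // -expr2.
rewrite -(ReR (_ ^+ 2)) -dotxx cproj_adj.
exact: le_trans (Re_le_nr _) (nr_dot _ _).
Qed.

Lemma defect_nonneg (U V : hilbertType R) (T : bop U V) :
  contractive T -> op_nonneg (\id_U - adj T \bo T).
Proof.
move=> /contractive_nrP Tc x.
rewrite !appE dotBl -adjPr !dotxx -rmorphB lecR subr_ge0.
by rewrite ler_pXn2r ?nnegrE ?nr_ge0.
Qed.

Lemma defect_sa (U V : hilbertType R) (T : bop U V) :
  contractive T -> selfadjoint (defect T).
Proof. by move=> Tc; have [/nonneg_selfadjoint] := bop_sqrtP (defect_nonneg Tc). Qed.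

Lemma defectE (U V : hilbertType R) (T : bop U V) :
  contractive T -> forall x, defect T (defect T x) = x - adj T (T x).
Proof. by move=> Tc x; have [_ ->] := bop_sqrtP (defect_nonneg Tc). Qed.

Lemma nr_defect (U V : hilbertType R) (T : bop U V) : contractive T ->
  forall x, nr (defect T x) ^+ 2 + nr (T x) ^+ 2 = nr x ^+ 2.
Proof.
move=> Tc x; apply: (@complexI R); rewrite rmorphD /= -!dotxx.
by rewrite defect_sa // defectE // dotBr -adjP subrK.
Qed.

Lemma adj_contractive (U V : hilbertType R) (T : bop U V) :
  contractive T -> contractive (adj T).
Proof.
move=> /contractive_nrP Tc; apply/contractive_nrP => x.
have [->|P0] := eqVneq (adj T x) 0; first by rewrite nr0 nr_ge0.
rewrite -(ler_pM2r (x := nr (adj T x))) ?nr_gt0 // -expr2.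
rewrite -(ReR (_ ^+ 2)) -dotxx -adjPr.
apply: le_trans (Re_le_nr _) (le_trans (nr_dot _ _) _).
by rewrite ler_wpM2l ?nr_ge0.
Qed.

Lemma B0_sa : selfadjoint (B0 B).
Proof.
move=> f g; rewrite /B0 !appE cproj_adj hB.2.
by rewrite -[csval f]/(cincl H0 f) cproj_adjl.
Qed.

Lemma B0_contractive : contractive (B0 B).
Proof.
apply/contractive_nrP => f; rewrite /B0 appE; apply: le_trans (nr_cproj _ _) _.
by move/contractive_nrP: hB.1.
Qed.

(* If no admissible contraction existed, [K0] would be the default value [0]. *)
Lemma K0_contractive : contractive (K0 B).
Proof.
have [h|h] := pselect (exists K : bop (csub (defect_space (B0 B))) (csub (Nsp H0)),
    contractive K /\ forall f, K (defect_to (B0 B) f) = cproj (Nsp H0) (B f)).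
  by have [] := xgetPex 0 h.
rewrite /K0 xgetPN ?appE; first by move=> x; rewrite appE normr0.
by move=> K hK; apply: h; exists K.
Qed.

Lemma defect_B0_comm x : B0 B (defect (B0 B) x) = defect (B0 B) (B0 B x).
Proof.
have [_ _] := bop_sqrtP (defect_nonneg B0_contractive); apply => y.
by rewrite (adj_sa B0_sa); move: (B0 B) => b; rewrite !appE bopB.
Qed.

Let Dk := defect (adj (K0 B)).
Let Kadj_contr := adj_contractive K0_contractive.

(** This is J^* for the map J of the overview: the parameter Z enters [block_op] only through J Z
    J^*. *)
Definition block_in : bop H (csub (Dsp B)) := defect_to (adj (K0 B)) \bo cproj (Nsp H0).

Lemma adj_block_in : adj block_in = cincl (Nsp H0) \bo Dk \bo cincl (Dsp B).
Proof.
rewrite /block_in /defect_to !adj_comp !adj_cproj adj_sa.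
  exact: bop_ext.
exact: (defect_sa Kadj_contr).
Qed.

Let fpart x := cproj H0 x.
Let kpart x := csval (adj (K0 B) (cproj (Nsp H0) x)).

(** Moving K0 and the defect operator of its adjoint to the other argument leaves three coordinates
    of x: f = [fpart x], k = [kpart x] and m = [block_in x]. The form is that of the Halmos matrix
    of B0 on (f, k) plus that of Z on m. *)
Lemma block_dot (Z : bop (csub (Dsp B)) (csub (Dsp B))) x y :
  '[block_op Z x, y] =
  '[B0 B (fpart x) + defect (B0 B) (kpart x), fpart y] +
  '[defect (B0 B) (fpart x) - B0 B (kpart x), kpart y] +
  '[Z (block_in x), block_in y].
Proof.
have -> : block_op Z x = cincl H0 (B0 B (fpart x)) +
    cincl H0 (defect (B0 B) (kpart x)) +
    cincl (Nsp H0) (K0 B (defect_to (B0 B) (fpart x))) +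
    (- cincl (Nsp H0) (K0 B (cproj (defect_space (B0 B)) (B0 B (kpart x)))) +
     cincl (Nsp H0) (Dk (cincl (Dsp B) (Z (block_in x))))) by [].
rewrite !dotDl !dotNl !cproj_adjl.
rewrite (defect_sa Kadj_contr (cincl _ _)) cproj_adjl !(adjP (K0 B)) !cproj_adj.
by rewrite !addrA.
Qed.

Lemma nr_decomp x : nr (fpart x) ^+ 2 + nr (cproj (Nsp H0) x) ^+ 2 = nr x ^+ 2.
Proof.
have PN : csval (cproj (Nsp H0) x) = x - csval (cproj H0 x).
  have hN : cset (Nsp H0) (x - csval (cproj H0 x)).
    by move=> v Hv; rewrite cprojP.
  have [n nE] := csub_of hN; rewrite -nE; congr csval; apply: cprojE => v Nv.
  rewrite nE subKr hdotC Nv ?rmorph0 //; exact: cset_csval.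
rewrite [nr (cproj _ x)]csval_nr PN [nr (fpart x)]csval_nr.
rewrite -[in RHS](subrK (csval (cproj H0 x)) x) [RHS]dot_sum_sq cprojP.
  by rewrite mulr0 addr0 addrC.
exact: (cset_csval (cproj H0 x)).
Qed.

(** The map x -> (f, k, m) is isometric, because the defect identity splits the N-component of x
    into k and m. The block operator is thus compressed from the direct sum of a unitary operator
    and Z. *)
Lemma block_num (Z : bop (csub (Dsp B)) (csub (Dsp B))) :
  (forall d, nr '[Z d, d] <= nr d ^+ 2) ->
  forall x, nr '[block_op Z x, x] <= nr x ^+ 2.
Proof.
move=> Zn x; rewrite block_dot.
set f := fpart x; set k := kpart x; set m := block_in x.
have split_n : nr k ^+ 2 + nr m ^+ 2 = nr (cproj (Nsp H0) x) ^+ 2.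
  rewrite -(nr_defect Kadj_contr) addrC; congr (_ ^+ 2 + _).
  by rewrite /m csval_nr /block_in /defect_to !appE cproj_ran.
(* [(u, v)] is the image of [(f, k)] under Halmos's unitary dilation
   [[B0, D], [D, - B0]] of [B0]. *)
set u := B0 B f + _; set v := defect (B0 B) f - _.
have uv : nr u ^+ 2 + nr v ^+ 2 = nr f ^+ 2 + nr k ^+ 2.
  rewrite /u /v dot_sum_sq dot_sub_sq.
  rewrite -(nr_defect B0_contractive f) -(nr_defect B0_contractive k).
  rewrite -/k; have -> : '[B0 B f, defect (B0 B) k] = '[defect (B0 B) f, B0 B k].
    by rewrite B0_sa defect_B0_comm (defect_sa B0_contractive).
  by ring.
have h1 := nr_leD ('[u, f] + '[v, k]) '[Z m, m].
have h2 := nr_leD '[u, f] '[v, k].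
have h3 := nr_dot u f; have h4 := nr_dot v k; have := Zn m.
have := nr_decomp x; rewrite -/f -split_n.
(* By the arithmetic-geometric inequality and [uv], |u| |f| + |v| |k| <= |f|^2 + |k|^2. *)
have := sqr_ge0 (nr u - nr f); have := sqr_ge0 (nr v - nr k).
by move: uv h1 h2 h3 h4; rewrite !sqrrB; nra.
Qed.

Lemma block_sa (Z : bop (csub (Dsp B)) (csub (Dsp B))) :
  selfadjoint Z -> selfadjoint (block_op Z).
Proof.
move=> Zsa x y; rewrite [RHS]hdotC !block_dot !rmorphD /= -!hdotC.
rewrite Zsa !dotE !B0_sa !(defect_sa B0_contractive); ring.
Qed.

Lemma block_diff (Z Z' : bop (csub (Dsp B)) (csub (Dsp B))) x :
  block_op Z x = block_op Z' x + adj block_in ((Z - Z') (block_in x)).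
Proof.
apply: dot_ext => y; rewrite dotDl !block_dot -adjPr bop_subE (dotBl (Z _)).
by rewrite -[RHS]addrA [_ + ('[Z _, _] - _)]addrCA subrr addr0.
Qed.

End BlockOperator.

(** * The theorem *)

Lemma adj_scaleR (R : realType) (U V : hilbertType R) (a : R) (T : bop U V) :
  adj (a%:C *: T) = a%:C *: adj T.
Proof. by apply: adjE => x y; rewrite !appE dotZl dotZrR adjP. Qed.

(** The reason is |1 + lam|^2 - |1 - lam|^2 = 4 Re lam. *)
Lemma cayley_lt1 (R : realType) (lam : R[i]) : complex.Re lam < 0 ->
  nr ((1 + lam) / (1 - lam)) < 1.
Proof.
move=> l0; have n0 : 0 < nr (1 - lam).
  rewrite nr_gt0 subr_eq0; apply: contraTneq l0 => <-.
  by rewrite /= -leNgt ler01.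
have nV : nr (1 - lam)^-1 = (nr (1 - lam))^-1.
  by apply: (@complexI R); rewrite fmorphV /= -!nrE normfV.
rewrite nrM nV ltr_pdivrMr // mul1r.
rewrite -(ltr_pXn2r (n := 2)) ?nnegrE ?nr_ge0 // !nr_sq.
by case: lam l0 {n0 nV} => a b /= a0; nra.
Qed.

Section Resolvent.
Variables (R : realType) (H : hilbertType R) (C : bop H H) (lam : R[i]).
Hypotheses (C_num : forall x, nr '[C x, x] <= nr x ^+ 2) (l0 : complex.Re lam < 0).

(** The spectral point is 1/z, and C - 1/z = - (I - z C) / z turns the resolvent into - z (I - z
    C)^(-1). At lam = -1 one has z = 0, so the conventional value 0 fits the same formula. *)
Lemma cayley_resolvent x : (if lam == -1 then 0
  else bop_inv (C - ((1 - lam) / (1 + lam)) *: \id_H)) x =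
  - ((1 + lam) / (1 - lam)) *: resolvent C ((1 + lam) / (1 - lam)) x.
Proof.
have z1 := cayley_lt1 l0; set z := (1 + lam) / (1 - lam) in z1 *.
have l1 : 1 - lam != 0.
  rewrite subr_eq0; apply: contraTneq l0 => <-.
  by rewrite /= -leNgt ler01.
have [lE|lN] := eqVneq lam (-1).
  by rewrite /z lE subrr mul0r oppr0 scale0r.
have l2 : 1 + lam != 0 by rewrite addrC -[1]opprK subr_eq0.
have z0 : z != 0 by rewrite mulf_neq0 ?invr_neq0.
have -> : (1 - lam) / (1 + lam) = z^-1 by rewrite invf_div.
have [h1 h2] := bop_invP (coercive_resolvent C_num z1).
have E y : (C - z^-1 *: \id_H) y = (- z^-1) *: ((\id_H - z *: C) y).
  by rewrite !appE scalerBr scalerA mulNr mulVf // scaleN1r opprK scaleNr addrC.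
rewrite (@bop_invE R H _ (- z *: resolvent C z)) //; apply: bop_ext => y.
  by rewrite bop_compE E bop_scaleE bopZ /resolvent h1 scalerA mulrNN mulfV // scale1r.
by rewrite bop_compE E bop_scaleE !bopZ /resolvent h2 scalerA mulrNN mulVf // scale1r.
Qed.

End Resolvent.

Theorem theorem4p4 (R : realType) (H G : hilbertType R)
    (sepH : separable_space H) (sepG : separable_space G)
    (H0 : csubspace H) (B : bop (csub H0) H) (hB : hermitian_contraction B)
    (X : bop (hsum (csub (Dsp B)) G) (hsum (csub (Dsp B)) G))
    (X_sa : selfadjoint X) (X_contr : contractive X) :
  let L : set G := range (bop_sqrt (\id_G + Theta X 0)) in
  let Delta := Bhat1 X - Bhat0 X in
  (forall lam : R[i], complex.Re lam < 0 -> closed_form_dom (Nrel X lam) = L) /\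
  (forall h, L h -> closure L (Yop X h)) /\
  exists2 V : bop (csub (ran_closure Delta)) G, isometric V &
    forall (lam : R[i]) (h g : G), complex.Re lam < 0 -> L h -> L g ->
      closed_form (Nrel X lam) h g =
      '[(\id_G + V \bo cproj (ran_closure Delta) \bo bop_sqrt Delta
               \bo Bhat0_res X lam
               \bo bop_sqrt Delta \bo cincl (ran_closure Delta) \bo adj V)
          (Yop X h), Yop X g].
Proof.
move=> L Delta.
have Th0 : Theta X 0 = X22 X by rewrite /Theta scale0r addr0.
pose Ap := bop_sqrt (\id_G + X22 X); pose Am := bop_sqrt (\id_G - X22 X).
have LE : L = range Ap by rewrite /L Th0.
have Ap_sa : selfadjoint Ap := sqrt_add_sa X_sa X_contr.
have Am_sa : selfadjoint Am := sqrt_sub_sa X_sa X_contr.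
have comm : forall x, Ap (Am x) = Am (Ap x) := sqrt_comm X_sa X_contr.
have sum_sq : forall x, Ap (Ap x) + Am (Am x) = x + x := sqrt_sum_sq X_sa X_contr.
have ApE : forall x, Ap (Ap x) = x + X22 X x := sqrt_addE X_sa X_contr.
have [Q [Q_coker Q21 Z0E Z1E [Z0_sa Z0_num]]] := shorted_pair X_sa X_contr.
rewrite -/(Zhat0 X) -/(Zhat1 X) in Z0E Z1E Z0_sa Z0_num.
rewrite -/(X22 X) -/Ap -/Am in Q_coker Q21 Z0E Z1E.
pose M := adj (block_in B) \bo adj Q.
have adjM x : adj M x = Q (block_in B x) by rewrite /M adj_comp !adj_adj.
have C0_num x : nr '[Bhat0 X x, x] <= nr x ^+ 2 by exact: block_num.
have C0_sa : selfadjoint (Bhat0 X) by exact: block_sa.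
have X11_num d : nr '[X11 X d, d] <= nr d ^+ 2.
  have := nr_num X_contr (hinl _ _ d); rewrite hsum_dotE /= dot0r addr0.
  have -> // : nr (hinl (csub (Dsp B)) G d) ^+ 2 = nr d ^+ 2.
  by apply: (@complexI R); rewrite -!dotxx hsum_dotE /= dot0r addr0.
have C_num x : nr '[Ctilde X x, x] <= nr x ^+ 2 by exact: block_num.
have CE x : Ctilde X x = Bhat0 X x + M (Am (Am (adj M x))).
  rewrite /Ctilde /Bhat0 (block_diff _ (Zhat0 X)) bop_subE Z0E adjM.
  by rewrite -/(X11 X) subKr.
have M_coker h : coker Ap (adj M h) by rewrite adjM.
have MtE : Mtilde X = M \bo Am \bo Ap.
  have -> : Mtilde X = adj (block_in B) \bo X12 X.
    by rewrite adj_block_in; exact: bop_ext.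
  have -> : X12 X = adj (blk21 X) by exact: blk12_adj.
  have -> : blk21 X = Ap \bo Am \bo Q by apply: bop_ext.
  rewrite (adj_comp _ Q) (adj_comp Ap) (adj_sa Ap_sa) (adj_sa Am_sa).
  exact: bop_ext.
have adjMt x : adj (Mtilde X) x = Ap (Am (adj M x)).
  by rewrite MtE (adj_comp _ Ap) (adj_comp M) (adj_sa Ap_sa) (adj_sa Am_sa).
have NE lam : complex.Re lam < 0 -> forall u u', Nrel X lam (u, u') <->
    exists h, u = Ap (pencil_inv Am M (Ctilde X) ((1 + lam) / (1 - lam)) (Ap h)) /\
      u' = h + h - u.
  move=> l0; set z := (1 + lam) / (1 - lam).
  (* Since [Mtilde] is M A- A+ and I + X22 is A+^2, a factor A+ comes out on each side; this is the
     shape A Fi A required by the closed form computation. *)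
  have ThE h : h + Theta X z h = Ap (pencil_inv Am M (Ctilde X) z (Ap h)).
    have -> : Theta X z h = X22 X h +
        z *: adj (Mtilde X) (resolvent (Ctilde X) z (Mtilde X h)) by [].
    have -> : pencil_inv Am M (Ctilde X) z (Ap h) =
        Ap h + z *: Am (adj M (resolvent (Ctilde X) z (M (Am (Ap h))))) by [].
    have -> : Mtilde X h = M (Am (Ap h)) by rewrite MtE.
    by rewrite adjMt bopD bopZ ApE addrA.
  have ThE' h : h - Theta X z h = h + h - (h + Theta X z h).
    by move: (Theta X z h) => t; rewrite opprD addrA addrK.
  move=> u u'; split.
    by move=> [h _ [<- <-]]; exists h; rewrite -ThE; split=> //; exact: ThE'.
  by move=> [h [-> ->]]; exists h; rewrite // -ThE -ThE'.
have form lam (l0 : complex.Re lam < 0) :=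
  transfer_relation_form Ap_sa Am_sa comm sum_sq M_coker C0_sa C0_num C_num CE
    (cayley_lt1 l0) (NE lam l0).
have Lrep h : L h -> exists2 x, coker Ap x & h = Ap x.
  rewrite LE => -[x _ <-]; exact: coker_preimage.
have Yx x : coker Ap x -> Yop X (Ap x) = Am x.
  by move=> hx; rewrite /Yop Th0 mp_invE.
split; first by move=> lam /form[-> _].
split.
  move=> h /Lrep[x hx ->]; rewrite Yx // LE; apply: coker_closure => //.
  (* A- commutes with A+, hence preserves the orthogonal complement of ker A+, which is contained in
     the closure of L. *)
  by move=> k k0; rewrite Am_sa hx // comm k0 bop0.
(* The factor makes T^* T = 2 M M^* equal to [Delta], since the entries Z1 and Z0 differ by Q^*
   (A+^2 + A-^2) Q = 2 Q^* Q. *)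
pose T := (Num.sqrt 2)%:C *: adj M.
have adjT x : adj T x = (Num.sqrt 2)%:C *: M x by rewrite /T adj_scaleR adj_adj.
have s2 : (Num.sqrt 2)%:C * (Num.sqrt 2)%:C = 2 :> R[i].
  by rewrite -rmorphM -expr2 sqr_sqrtr // rmorph_nat.
have DE x : Delta x = adj T (T x).
  rewrite adjT /T bop_scaleE bopZ scalerA s2 adjM /M bop_compE.
  rewrite /Delta bop_subE /Bhat1 /Bhat0 (block_diff (Zhat1 X) (Zhat0 X)).
  rewrite [_ + adj _ _]addrC addrK -bopZ; congr (adj _ _).
  rewrite bop_subE Z1E Z0E; move: (block_in B x) => d.
  rewrite scaler_nat mulr2n -bopD -sum_sq bopD.
  move: (blk11 X d) (adj Q (Ap _)) (adj Q (Am _)) => a p m.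
  by rewrite opprB [a + p]addrC addrACA subrr addr0.
have [V V_iso VE] := polar_isometry DE.
exists V => // lam h g l0 /Lrep[x hx ->] /Lrep[y hy ->].
rewrite !Yx // (form lam l0).2 //; congr ('[_, _]).
(* Adjoint form of the polar relation V S = T. It removes V and both roots of [Delta] from the
   right-hand side, leaving T Bhat0_res T^*, where the two square roots of 2 and the factor - z give
   the coefficient - 2 z. *)
have SV u : bop_sqrt Delta (cincl (ran_closure Delta) (adj V u)) = adj T u.
  have S_sa : selfadjoint (bop_sqrt Delta).
    by have [/nonneg_selfadjoint] := bop_sqrtP (polar_nonneg DE).
  apply: dot_ext_r => w; rewrite -S_sa -(adjP T) -VE.
  by rewrite (adjP V) cproj_adj.
rewrite bop_addE bop_idE !bop_compE SV VE /T bop_scaleE adjT.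
rewrite /Bhat0_res (cayley_resolvent C0_num l0) !bopZ !scalerA.
congr (_ + _); rewrite -scaleNr; congr (_ *: _).
by rewrite [RHS]mulrCA s2 mulNr mulrC.
Qed.
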